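(* Let $\lambda_0,\lambda_1,\lambda_2>0$, $\lambda=\lambda_0+\lambda_1+\lambda_2$, let the claim sizes $Y_{ki}$, the vectors $(I_{1i},I_{2i},I_{0i})$ and the random variable $\eta$ be as in the context, and suppose $\mathbb{E}Y_{k1}<\infty$ for $k=1,2,3,4$. Put $$D=\lambda_1\mathbb{E}Y_{11}+\lambda_2\mathbb{E}Y_{21}+\lambda_0(\mathbb{E}Y_{31}+\mathbb{E}Y_{41}),\qquad p_1=\frac{\lambda_1\mathbb{E}Y_{11}}{D},\quad p_2=\frac{\lambda_2\mathbb{E}Y_{21}}{D},\quad p_0=\frac{\lambda_0(\mathbb{E}Y_{31}+\mathbb{E}Y_{41})}{D},$$ and let $(J_{11},J_{21},J_{01})$ be a random vector taking the values $(1,0,0)$, $(0,1,0)$, $(0,0,1)$ with probabilities $p_1,p_2,p_0$ respectively. Then the integrated tail distribution of $Y_1:=I_{11}Y_{11}+I_{01}(Y_{31}+Y_{41})+I_{21}Y_{21}$ is the mixture with c.d.f., for $y\ge0$, $$\frac{1}{\mathbb{E}Y_1}\int_0^y\mathbb{P}(Y_1\ge x)\,dx=\frac{p_1}{\mathbb{E}Y_{11}}\int_0^y\mathbb{P}(Y_{11}\ge x)\,dx+\frac{p_0}{\mathbb{E}Y_{31}+\mathbb{E}Y_{41}}\int_0^y\mathbb{P}(Y_{31}+Y_{41}\ge x)\,dx+\frac{p_2}{\mathbb{E}Y_{21}}\int_0^y\mathbb{P}(Y_{21}\ge x)\,dx.$$ Consequently, if the random variables $\theta_1,\theta_2,\theta_0$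 have the integrated tail distributions of $Y_{11}$, $Y_{21}$ and $Y_{31}+Y_{41}$ respectively, and $(\theta_1,\theta_2,\theta_0)$ is independent of $(J_{11},J_{21},J_{01})$, then $$\eta\stackrel{d}{=}J_{11}\theta_1+J_{21}\theta_2+J_{01}\theta_0.$$
   Context: The integrated tail distribution of a nonnegative random variable $Y$ with $0<\mathbb{E}Y<\infty$ is the distribution on $[0,\infty)$ with c.d.f. $y\mapsto\frac{1}{\mathbb{E}Y}\int_0^y\mathbb{P}(Y\ge x)\,dx$, $y\ge 0$. For each $k=1,2,3,4$ the random variables $Y_{k1},Y_{k2},\dots$ are i.i.d. and almost surely strictly positive; the pairs $(Y_{3i},Y_{4i})$, $i\ge1$, are i.i.d. (the two coordinates of a pair may be dependent). The random vectors $(I_{1i},I_{2i},I_{0i})$, $i\ge1$, are i.i.d. and take the values $(1,0,0)$, $(0,1,0)$, $(0,0,1)$ with probabilities $\lambda_1/\lambda$, $\lambda_2/\lambda$, $\lambda_0/\lambda$. $N$ is a homogeneous Poisson process with parameter $\lambda$, $N(0)=0$. $N$ and the sequences $\{Y_{1i}\}_{i\ge1}$, $\{Y_{2i}\}_{i\ge1}$, $\{(Y_{3i},Y_{4i})\}_{i\ge1}$, $\{(I_{1i},I_{2i},I_{0i})\}_{i\ge1}$ are mutually independent. Put $Y_i=I_{1i}Y_{1i}+I_{0i}(Y_{3i}+Y_{4i})+I_{2i}Y_{2i}$ for $i\ge1$. The risk reserve process with initial capital $0$ and premium rate $c>0$ is $R_0(t)=ct-\sum_{i=1}^{N(t)}Y_i$,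 and the time of ruin is $\tau(0)=\inf\{t>0:R_0(t)<0\}$ ($\inf\emptyset=\infty$). The net profit condition $c>\lambda_1\mathbb{E}Y_{11}+\lambda_2\mathbb{E}Y_{21}+\lambda_0(\mathbb{E}Y_{31}+\mathbb{E}Y_{41})$ is assumed. The random variable $\eta$ is the absolute value of the deficit at ruin given that ruin occurs, i.e. its law is the conditional law of $-R_0(\tau(0)^+)$ given $\tau(0)<\infty$. By the classical Cramér–Lundberg theory, recalled in the paper before this result, $\eta$ has the integrated tail distribution of $Y_1$: $\mathbb{P}(\eta\le x)=\frac{1}{\mathbb{E}Y_1}\int_0^x\mathbb{P}(Y_1\ge y)\,dy$ for $x\ge0$. *)

(* Defs.v *)
From mathcomp Require Export all_boot all_order all_algebra.
From mathcomp Require Export all_classical all_reals all_analysis.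
Export numFieldNormedType.Exports.

Set Implicit Arguments.
Unset Strict Implicit.
Unset Printing Implicit Defensive.

Import Order.TTheory GRing.Theory Num.Theory.

Local Open Scope classical_set_scope.
Local Open Scope ring_scope.

Section sigma_algebras.
Context {d d' : measure_display} {T : measurableType d} {U : measurableType d'}.

Definition sigma_rv (X : T -> U) : set (set T) :=
  preimage_set_system setT X measurable.

Definition sigma_family {I : Type} (D : set I) (X : I -> T -> U) :
    set (set T) :=
  <<s \bigcup_(i in D) sigma_rv (X i) >>.

End sigma_algebras.

Section independence.
Context {d : measure_display} {T : measurableType d} {R : realType}.
Variable P : probability T R.

Definition mutually_independent {I : eqType} (F : I -> set (set T)) : Prop :=
  forall (J : seq I) (E : I -> set T), uniq J ->
    (forall i, i \in J -> F i (E i)) ->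
    P (\bigcap_(i in [set` J]) E i) = (\prod_(i <- J) P (E i))%E.

Definition independent2 (F G : set (set T)) : Prop :=
  forall A B, F A -> G B -> P (A `&` B) = (P A * P B)%E.

End independence.

(* Equality of laws is only required on measurable sets: the values of
   [pushforward] elsewhere carry no information. *)
Definition same_law {d d' d0 : measure_display} {T : measurableType d}
    {T' : measurableType d'} {U : measurableType d0} {R : realType}
    (P : probability T R) (X : T -> U) (P' : probability T' R) (X' : T' -> U) :
    Prop :=
  forall A : set U, measurable A -> P (X @^-1` A) = P' (X' @^-1` A).

Definition iid {d d' : measure_display} {T : measurableType d}
    {U : measurableType d'} {R : realType} (P : probability T R)
    (X : nat -> T -> U) : Prop :=
  mutually_independent P (fun i => sigma_rv (X i)) /\
  forall i, same_law P (X i) P (X 0%N).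

Definition one_hot_law {d : measure_display} {T : measurableType d}
    {R : realType} (P : probability T R) (A B C : T -> R) (a b c : R) : Prop :=
  [/\ P [set w | [/\ A w = 1, B w = 0 & C w = 0]] = a%:E,
      P [set w | [/\ A w = 0, B w = 1 & C w = 0]] = b%:E &
      P [set w | [/\ A w = 0, B w = 0 & C w = 1]] = c%:E].

(* N is the counting process of the arrival epochs S_0 + ... + S_n, n >= 0,
   with i.i.d. exponential gaps: n <= N t iff the n-th arrival is not after t.
   Since the gaps are positive and N is finite at every point of the sample
   space (no exceptional null set), N 0 = 0 and every path is a
   right-continuous step function; this keeps the ruin event and the deficit
   measurable.  Only times t >= 0 are meaningful. *)
Definition poisson_process {d : measure_display} {T : measurableType d}
    {R : realType} (P : probability T R) (lam : R) (N : R -> T -> nat) : Prop :=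
  exists S : nat -> {RV P >-> R},
    [/\ iid P (S : nat -> T -> R),
        forall A : set R, measurable A ->
          P (S 0%N @^-1` A) = exponential_prob lam A,
        forall n w, 0 < S n w &
        forall t w n, 0 <= t -> (n <= N t w)%N = (\sum_(k < n) S k w <= t)].

Section integrated_tail.
Context {d : measure_display} {T : measurableType d} {R : realType}.
Variable P : probability T R.
Local Open Scope ereal_scope.

Definition tail_integral (Y : T -> R) (y : R) : \bar R :=
  \int[lebesgue_measure]_(x in `[0%R, y]) P [set w | (x <= Y w)%R].

Definition itail_cdf (Y : T -> R) (y : R) : \bar R :=
  ('E_P[Y])^-1 * tail_integral Y y.

End integrated_tail.

Definition has_itail_law {d d' : measure_display} {T : measurableType d}
    {T' : measurableType d'} {R : realType}
    (P' : probability T' R) (theta : T' -> R) (P : probability T R)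
    (Y : T -> R) : Prop :=
  P' [set w | theta w < 0] = 0%E /\
  forall y : R, 0 <= y -> P' [set w | theta w <= y] = itail_cdf P Y y.

Section ruin.
Context {T : Type} {R : realType}.
Variables (c : R) (N : R -> T -> nat) (Y : nat -> T -> R).

Definition reserve (t : R) (w : T) : R := c * t - \sum_(i < N t w) Y i w.

Definition ruin_time (w : T) : \bar R :=
  ereal_inf [set t%:E | t in [set t : R | 0 < t /\ reserve t w < 0]].

Definition ruin : set T := [set w | (ruin_time w < +oo)%E].

(* Meaningful on [ruin] only. *)
Definition deficit (w : T) : R :=
  - lim (reserve t w @[t --> (fine (ruin_time w))^'+]).

End ruin.

Definition cond_prob {d : measure_display} {T : measurableType d}
    {R : realType} (P : probability T R) (A B : set T) : \bar R :=
  (P (A `&` B) / P B)%E.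

(* Main.v *)
Require Import Defs.
From mathcomp Require Import measurable_realfun.
From mathcomp Require Import ring.

(** Write X_k = Y_k - c S_k, where S_k is the gap before the claim Y_k. The
    reserve increases between claims, so ruin can only happen at a claim: the
    reserve after n claims is the walk -(X_0 + ... + X_(n-1)), ruin is the
    first passage of this walk below 0, and the deficit is the depth reached
    there. The variable c S_k is exponential with rate m = lam / c.

    The law of the deficit. For a function h of the reserve, supported by the
    negative numbers, the mean of h over the exit positions is the sum over k
    of the terms passage h k 0, the mean over the paths that exit at step k.
    The renewal measure of a Poisson process of rate m is m times Lebesgue
    measure on the half-line (exponential_renewal); averaged over the claim,
    this gives
      passage h 0 0 + m * (integral over u >= 0 of passage h 0 u)
        = m * overshoot h,
    where overshoot h is the mean over Y of the integral over u >= 0 of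
    h (u - Y). The same identity applied to passage h n in place of h
    telescopes (sum_passage):
      (sum over k <= n of passage h k 0)
        + m * (integral over u >= 0 of passage h n u) = m * overshoot h.
    The remainder tends to 0 under the net profit condition. Indeed, by
    invariance of Lebesgue measure the killed walk is in duality with the
    reversed walk, and the integral becomes that of survival n times a fixed
    integrable function (integral_passage), where survival n v is the
    probability that the reversed walk from v stays nonnegative for n steps.
    The function v + 1 / m loses exactly 1 / m - E Y > 0 on average at each
    step of the killed reversed walk (cotransition_V), so survival n v tends
    to 0. Hence the deficit on the event of ruin has the law m * overshoot
    (ladder_sum, deficit_law). For h the indicator of [-t, 0), Fubini turns
    overshoot h into the integral of P (Y >= x) over [0, t], and for that of
    the negative numbers it is E Y: given ruin, the deficit has the integrated
    tail distribution of the claims (deficit_integrated_tail).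

    The mixture. A vector that selects one of three variables, independently of
    each of them, mixes their laws (one_hot_mixture). For the claims the
    weights are l1 / lam, l2 / lam, l0 / lam; tail integrals are linear in the
    law, and division by E Y = D / lam gives the formula with weights p1, p2,
    p0. Applied to the vector J and the variables theta, the same lemma gives
    the same c.d.f. to the mixture of the theta, and a c.d.f. determines a
    law. *)

Import Order.TTheory GRing.Theory Num.Theory.
Import HBNNSimple.
Local Open Scope classical_set_scope.
Local Open Scope ring_scope.
Set Implicit Arguments.
Unset Strict Implicit.
Unset Printing Implicit Defensive.

(** * Lebesgue measure and densities *)

Section lebesgue_and_densities.
Context {R : realType}.
Local Notation leb := (@lebesgue_measure R).
Local Open Scope ereal_scope.

Lemma lebesgue_measure_shift (a : R) (A : set R) : measurable A ->
  pushforward leb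
    ((fun u => u + a)%R : measurableTypeR R -> measurableTypeR R) A
  = leb A.
Proof.
move=> mA.
have mf : measurable_fun [set: measurableTypeR R]
    ((fun u => u + a)%R : measurableTypeR R -> measurableTypeR R).
  exact: measurable_funD.
pose nu := pushforward leb
  ((fun u => u + a)%R : measurableTypeR R -> measurableTypeR R).
apply/esym; rewrite (@lebesgue_measure_unique R nu) // => _ [[b c]] /= _ <-.
rewrite /nu /pushforward.
rewrite [X in _ = leb X](_ : _ = `](b - a)%R, (c - a)%R]%classic); last first.
  by apply/seteqP; split=> u /=; rewrite !in_itv/= ltrBlDr lerBrDr.
rewrite !lebesgue_measure_itv/= !lte_fin ltrD2r.
by case: ifP => // _; rewrite -!EFinD opprB addrA addrNK.
Qed.

Lemma integral_lebesgue_shift (a : R) (f : R -> \bar R) :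
  measurable_fun setT f -> (forall u, 0 <= f u) ->
  \int[leb]_u f (u + a)%R = \int[leb]_u f u.
Proof.
move=> mf f0.
have ms : measurable_fun [set: measurableTypeR R]
    ((fun u => u + a)%R : measurableTypeR R -> measurableTypeR R).
  exact: measurable_funD.
transitivity (\int[pushforward leb ((fun u => u + a)%R :
     measurableTypeR R -> measurableTypeR R)]_u f u); last first.
  by apply: eq_measure_integral => A mA _; exact: lebesgue_measure_shift.
by rewrite ge0_integral_pushforward.
Qed.

Lemma integral_probability_cst d (T : measurableType d) (P : probability T R)
    (r : \bar R) : \int[P]_w cst r w = r.
Proof.
by rewrite integral_cst// -[RHS]mule1; congr (_ * _); exact: probability_setT.
Qed.

Lemma mule_pI (m : R) (x y : \bar R) : (0 < m)%R ->
  m%:E * x = m%:E * y -> x = y.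
Proof.
move=> m0 xy; have mE0 : 0 < m%:E by rewrite lte_fin.
have le_m := lee_pmul2l (x := m%:E) isT mE0.
by apply/eqP; rewrite eq_le -[X in X && _]le_m -[X in _ && X]le_m xy lexx.
Qed.

(** The density p is only given through the measures of sets: that is the case
    of simple functions, and monotone convergence does the rest. *)
Lemma ge0_integral_density d (T : measurableType d)
    (mu nu : {measure set T -> \bar R}) (p : T -> R) (f : T -> \bar R) :
  measurable_fun setT p -> (forall x, (0 <= p x)%R) ->
  (forall A, measurable A -> nu A = \int[mu]_(x in A) (p x)%:E) ->
  measurable_fun setT f -> (forall x, 0 <= f x) ->
  \int[nu]_x f x = \int[mu]_x (f x * (p x)%:E).
Proof.
move=> mp p0 nuE mf f0.
have mEp : measurable_fun setT (EFin \o p) by exact/measurable_EFinP.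
pose f_ := nnsfun_approx measurableT mf.
have f_f x : (f_ n x)%:E @[n --> \oo] --> f x by apply: cvg_nnsfun_approx.
have f_nd x : {homo (fun n => (f_ n x)%:E) : n m / (n <= m)%N >-> n <= m}.
  by move=> n m nm; rewrite lee_fin; exact/lefP/nd_nnsfun_approx.
transitivity (limn (fun n => \int[nu]_x (f_ n x)%:E)).
  rewrite -monotone_convergence//=.
  - by apply: eq_integral => x _; apply/esym/cvg_lim.
  - by move=> n; exact/measurable_EFinP/measurable_funTS.
  - by move=> n x _; rewrite lee_fin.
transitivity (limn (fun n => \int[mu]_x ((f_ n x)%:E * (p x)%:E))); last first.
  rewrite -monotone_convergence//=.
  - by apply: eq_integral => x _; apply/cvg_lim => //; exact: cvgeZr.
  - by move=> n; apply: emeasurable_funM => //;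
      exact/measurable_EFinP/measurable_funTS.
  - by move=> n x _; rewrite mule_ge0// lee_fin.
  - by move=> x _ n m nm; rewrite lee_wpmul2r ?lee_fin//; exact: f_nd.
congr (limn _); apply/funext => n.
have mind r : measurable_fun setT
    (fun x => r%:E * (\1_(f_ n @^-1` [set r]) x : R)%:E).
  by apply/measurable_EFinP; exact: measurable_funM.
under eq_integral do rewrite fimfunE -fsumEFin//.
rewrite ge0_integral_fsum; [|by []|exact: mind| |by []]; last first.
  by move=> r x _; exact: nnfun_muleindic_ge0.
under [RHS]eq_integral => x _.
  rewrite fimfunE -fsumEFin// ge0_mule_fsuml; last first.
    by move=> r; exact: nnfun_muleindic_ge0.
  over.
rewrite ge0_integral_fsum; [|by []| | |by []]; last 2 first.
  - by move=> r; exact: (emeasurable_funM (mind r) mEp).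
  - move=> r x _; apply: mule_ge0; last by rewrite lee_fin.
    by rewrite EFinM; exact: nnfun_muleindic_ge0.
apply: eq_fsbigr => r _.
have [r0|r0] := ltP r 0%R.
  rewrite preimage_nnfun0// !integral0_eq// => x _;
    by rewrite indic0 mulr0 ?mul0e.
under [RHS]eq_integral do rewrite EFinM -muleA.
under eq_integral do rewrite EFinM.
rewrite !ge0_integralZl//.
- rewrite integral_indic// setIT nuE// integral_mkcond; congr (_ * _).
  by apply: eq_integral => x _; rewrite epatch_indic muleC.
- by apply: emeasurable_funM => //; exact/measurable_EFinP.
- by move=> x _; rewrite mule_ge0// lee_fin.
- exact/measurable_EFinP.
Qed.

End lebesgue_and_densities.

(** * Killing below zero, and the renewal measure of the exponential law *)

Lemma tonelli {R : realType} d1 d2 (T1 : measurableType d1)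
    (T2 : measurableType d2) (m1 : {sigma_finite_measure set T1 -> \bar R})
    (m2 : {sigma_finite_measure set T2 -> \bar R}) (f : T1 -> T2 -> \bar R) :
  measurable_fun setT (fun p => f p.1 p.2) -> (forall x y, (0 <= f x y)%E) ->
  (\int[m1]_x \int[m2]_y f x y = \int[m2]_y \int[m1]_x f x y)%E.
Proof.
move=> mf f0.
by apply: (fubini_tonelli (fun p => f p.1 p.2) mf) => -[x y]; exact: f0.
Qed.

Section cut.
Context {R : realType}.
Local Open Scope ereal_scope.
Implicit Types f g : R -> \bar R.

(** Alternating cut with the step of a walk kills the paths that go below 0. *)
Definition cut f (u : R) : \bar R := if (0 <= u)%R then f u else 0.

Lemma measurable_cut f : measurable_fun setT f -> measurable_fun setT (cut f).
Proof.
by move=> mf; apply: measurable_fun_ifT => //; exact: measurable_fun_ler.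
Qed.

Lemma cut_ge0 f : (forall u, 0 <= f u) -> forall u, 0 <= cut f u.
Proof. by move=> f0 u; rewrite /cut; case: ifP. Qed.

Lemma cut_pos f u : (0 <= u)%R -> cut f u = f u.
Proof. by rewrite /cut => ->. Qed.

Lemma cut_neg f u : (u < 0)%R -> cut f u = 0.
Proof. by rewrite /cut leNgt => ->. Qed.

End cut.

Section exponential_law.
Context {R : realType}.
Variable m : R.
Hypothesis m0 : (0 < m)%R.
Local Notation leb := (@lebesgue_measure R).
Local Notation pdf := (exponential_pdf m).
Local Open Scope ereal_scope.

Let mpdf : measurable_fun setT (EFin \o pdf).
Proof. by apply/measurable_EFinP; exact: measurable_exponential_pdf. Qed.

Let pdf0 s : 0 <= (pdf s)%:E.
Proof. by rewrite lee_fin exponential_pdf_ge0// ltW. Qed.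

Lemma exponential_cdf (t : R) :
  \int[leb]_s (if (s <= t)%R then (pdf s)%:E else 0) =
  if (0 <= t)%R then (1 - expR (- m * t))%:E else 0.
Proof.
transitivity (exponential_prob m `[0%R, t]).
  rewrite /exponential_prob [RHS]integral_mkcond; apply: eq_integral => s _.
  rewrite patchE; case: ifPn => st; case: ifPn => //.
    rewrite notin_setE /= in_itv/= st andbT => /negP; rewrite -ltNge => s0.
    by rewrite lt0_exponential_pdf.
  by rewrite inE/= in_itv/= (negPf st) andbF.
have [t0|t0|<-] := ltgtP 0%R t.
- by rewrite exponential_prob_itv0c.
- by rewrite /exponential_prob set_itv_ge ?integral_set0// -leNgt bnd_simp.
- by rewrite /exponential_prob set_itv1 integral_set1 mulr0 expR0 subrr.
Qed.

(** The renewal measure of a Poisson process of rate m is m times Lebesgue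
    measure on the half-line, and this is its renewal equation. By Fubini, both
    sides integrate h against a density, and for t >= 0 the identity is
    pdf t + m * K t = m, with K the exponential c.d.f. *)
Lemma exponential_renewal (h : R -> \bar R) :
  measurable_fun setT h -> (forall s, 0 <= h s) ->
  \int[leb]_s (h s * (pdf s)%:E)
    + m%:E * \int[leb]_u cut (fun u => \int[leb]_s (h (u + s)%R * (pdf s)%:E)) u
  = m%:E * \int[leb]_u cut h u.
Proof.
move=> mh h0.
(* The convolution of the law with Lebesgue measure on the half-line has density
   K. *)
pose K (t : R) := \int[leb]_s (if (s <= t)%R then (pdf s)%:E else 0).
have mpdf2 : measurable_fun setT (fun p : R * R => (pdf p.2)%:E).
  by exact: (measurableT_comp mpdf measurable_snd).
have -> : \int[leb]_u cut (fun u => \int[leb]_s (h (u + s)%R * (pdf s)%:E)) u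
    = \int[leb]_t (h t * K t).
  transitivity (\int[leb]_u \int[leb]_s
      (cut (fun u => h (u + s)%R) u * (pdf s)%:E)).
    apply: eq_integral => u _; rewrite /cut; case: ifPn => // _.
    by under [RHS]eq_integral do rewrite mul0e; rewrite integral0.
  rewrite (@tonelli _ _ _ _ _ leb leb (fun u s =>
      cut (fun u => h (u + s)%R) u * (pdf s)%:E)); last 2 first.
    - apply: emeasurable_funM => //; apply: measurable_fun_ifT => //.
        exact: (measurable_fun_ler (measurable_cst _) measurable_fst).
      exact: (measurableT_comp mh
        (measurable_funD measurable_fst measurable_snd)).
    - by move=> u s; rewrite mule_ge0//; apply: cut_ge0.
  transitivity (\int[leb]_s \int[leb]_t
      ((if (s <= t)%R then h t else 0) * (pdf s)%:E)).
    apply: eq_integral => s _.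
    rewrite -[RHS](integral_lebesgue_shift s); last 2 first.
      - apply: emeasurable_funM => //; apply: measurable_fun_ifT => //.
        exact: measurable_fun_ler.
      - by move=> t; rewrite mule_ge0//; case: ifP.
    by apply: eq_integral => u _; rewrite /cut lerDr.
  rewrite (@tonelli _ _ _ _ _ leb leb (fun s t =>
      (if (s <= t)%R then h t else 0) * (pdf s)%:E)); last 2 first.
    - apply: emeasurable_funM => //; last first.
        by exact: (measurableT_comp mpdf measurable_fst).
      apply: measurable_fun_ifT => //.
        exact: (measurable_fun_ler measurable_fst measurable_snd).
      by exact: (measurableT_comp mh measurable_snd).
    - by move=> u s; rewrite mule_ge0//; case: ifP.
  apply: eq_integral => t _; rewrite -ge0_integralZl//.
  - by apply: eq_integral => s _; case: ifP => // _; rewrite mul0e mule0.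
  - by apply: measurable_fun_ifT => //; exact: measurable_fun_ler.
  - by move=> s _; case: ifP.
have KE t : K t = if (0 <= t)%R then (1 - expR (- m * t))%:E else 0.
  exact: exponential_cdf.
have K0 t : 0 <= K t by apply: integral_ge0 => s _; case: ifP.
have mK : measurable_fun setT K.
  apply: (measurable_fun_fubini_tonelli_F (m2 := leb) (fun p : R * R =>
      if (p.2 <= p.1)%R then (pdf p.2)%:E else 0)) => [|p]; last by case: ifP.
  apply: measurable_fun_ifT => //.
  exact: (measurable_fun_ler measurable_snd measurable_fst).
rewrite -!ge0_integralZl// -?ge0_integralD//.
- apply: eq_integral => t _; rewrite KE /cut.
  case: leP => t0; last by rewrite lt0_exponential_pdf// !mule0 adde0.
  rewrite exponential_pdfE// muleCA -ge0_muleDr; last 2 first.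
  - by rewrite lee_fin mulr_ge0 ?expR_ge0 ?ltW.
  - rewrite -EFinM lee_fin mulr_ge0// ?(ltW m0)//.
    by rewrite subr_ge0 -expR0 ler_expR mulNr oppr_le0 mulr_ge0// ltW.
  by rewrite -EFinM -EFinD mulrBr mulr1 addrC subrK muleC.
- by move=> s _; rewrite mule_ge0.
- exact: emeasurable_funM.
- by move=> s _; rewrite !mule_ge0// lee_fin ltW.
- by apply: emeasurable_funM => //; exact: emeasurable_funM.
- exact: measurable_cut.
- by move=> u _; exact: cut_ge0.
- by rewrite lee_fin ltW.
- exact: emeasurable_funM.
- by move=> s _; rewrite mule_ge0.
- by rewrite lee_fin ltW.
Qed.

End exponential_law.

(** * The walk killed below zero and its dual *)

Section killed_walk.
Context {R : realType} {d : measure_display} {Omega : measurableType d}.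
Variables (P : probability Omega R) (X : Omega -> R).
Hypothesis mX : measurable_fun setT X.
Local Notation leb := (@lebesgue_measure R).
Local Open Scope ereal_scope.
Implicit Types a f h : R -> \bar R.

(** The walk moves by -X, as the reserve does at each claim. *)
Definition transition f (u : R) : \bar R := \int[P]_w f (u - X w)%R.

(** The adjoint of f |-> transition (cut f) for Lebesgue measure on the
    half-line: one step of the time-reversed walk. *)
Definition cotransition a (v : R) : \bar R := \int[P]_w cut a (v + X w)%R.

(** The mean of h at time n.+1 over the paths from u that are nonnegative at the
    times 1, ..., n. *)
Definition passage h n : R -> \bar R :=
  iter n (fun f => transition (cut f)) (transition h).

(** The probability that the reversed walk from v is nonnegative at the times
    1, ..., n. *)
Definition survival n : R -> \bar R := iter n cotransition (cst 1).

Let mshiftB : measurable_fun setT (fun p : R * Omega => (p.1 - X p.2)%R).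
Proof.
exact: (measurable_funB measurable_fst (measurableT_comp mX measurable_snd)).
Qed.

Let mshiftD : measurable_fun setT (fun p : R * Omega => (p.1 + X p.2)%R).
Proof.
exact: (measurable_funD measurable_fst (measurableT_comp mX measurable_snd)).
Qed.

Let mcutD a v : measurable_fun setT a ->
  measurable_fun setT (fun w => cut a (v + X w)%R).
Proof.
move=> ma; exact: (measurableT_comp (measurable_cut ma)
  (measurable_funD (measurable_cst v) mX)).
Qed.

Let mcutB f u : measurable_fun setT f ->
  measurable_fun setT (fun w => cut f (u - X w)%R).
Proof.
move=> mf; exact: (measurableT_comp (measurable_cut mf)
  (measurable_funB (measurable_cst u) mX)).
Qed.

Lemma transition_ge0 f : (forall u, 0 <= f u) -> forall u, 0 <= transition f u.
Proof. by move=> f0 u; exact: integral_ge0. Qed.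

Lemma measurable_transition f : measurable_fun setT f -> (forall u, 0 <= f u) ->
  measurable_fun setT (transition f).
Proof.
move=> mf f0.
apply: (measurable_fun_fubini_tonelli_F (m2 := P)
  (fun p : R * Omega => f (p.1 - X p.2)%R)) => //.
exact: (measurableT_comp mf mshiftB).
Qed.

Lemma cotransition_ge0 a : (forall u, 0 <= a u) ->
  forall v, 0 <= cotransition a v.
Proof. by move=> a0 v; apply: integral_ge0 => w _; exact: cut_ge0. Qed.

Lemma measurable_cotransition a : measurable_fun setT a ->
  (forall u, 0 <= a u) -> measurable_fun setT (cotransition a).
Proof.
move=> ma a0.
apply: (measurable_fun_fubini_tonelli_F (m2 := P)
  (fun p : R * Omega => cut a (p.1 + X p.2)%R)).
  exact: (measurableT_comp (measurable_cut ma) mshiftD).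
by move=> p; exact: cut_ge0.
Qed.

Lemma passage_ge0 h n : (forall u, 0 <= h u) -> forall u, 0 <= passage h n u.
Proof.
move=> h0; case: n => [|n] u; first exact: transition_ge0.
elim: n u => [|n ih] u; apply: transition_ge0 => v; apply: cut_ge0.
  exact: transition_ge0.
exact: ih.
Qed.

Lemma measurable_passage h n : measurable_fun setT h -> (forall u, 0 <= h u) ->
  measurable_fun setT (passage h n).
Proof.
move=> mh h0; elim: n => [|n ih]; first exact: measurable_transition.
apply: measurable_transition; first exact: measurable_cut.
by apply: cut_ge0; exact: passage_ge0.
Qed.

Lemma survival_ge0 n v : 0 <= survival n v.
Proof. by elim: n v => [|n ih] v //=; exact: cotransition_ge0. Qed.

Lemma measurable_survival n : measurable_fun setT (survival n).
Proof.
elim: n => [|n ih]; first exact: measurable_cst.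
by apply: measurable_cotransition => //; exact: survival_ge0.
Qed.

Lemma survival_le1 n v : survival n v <= 1.
Proof.
elim: n v => [|n ih] v //=.
rewrite -(integral_probability_cst P 1).
apply: ge0_le_integral => //.
- by move=> w _; apply: cut_ge0; exact: survival_ge0.
- exact: (mcutD v (measurable_survival n)).
- by move=> w _; rewrite /cut; case: ifP.
Qed.

Lemma cut_mull a f u : cut (fun v => a v * f v) u = cut a u * f u.
Proof. by rewrite /cut; case: ifP; rewrite ?mul0e. Qed.

Lemma cut_mulr a f u : cut (fun v => a v * f v) u = a u * cut f u.
Proof. by rewrite /cut; case: ifP; rewrite ?mule0. Qed.

(** Substitution of v = u - X in the integral over u. *)
Lemma transition_duality a f :
  measurable_fun setT a -> (forall u, 0 <= a u) ->
  measurable_fun setT f -> (forall u, 0 <= f u) ->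
  \int[leb]_u cut (fun u => a u * transition (cut f) u) u =
  \int[leb]_v cut (fun v => cotransition a v * f v) v.
Proof.
move=> ma a0 mf f0.
have mca := measurable_cut ma; have mcf := measurable_cut mf.
have ca0 := cut_ge0 a0; have cf0 := cut_ge0 f0.
transitivity (\int[leb]_u \int[P]_w (cut a u * cut f (u - X w)%R)).
  apply: eq_integral => u _; rewrite cut_mull ge0_integralZl//.
  exact: mcutB.
rewrite (@tonelli _ _ _ _ _ leb P (fun u w => cut a u * cut f (u - X w)%R));
  last 2 first.
  - exact: (emeasurable_funM (measurableT_comp mca measurable_fst)
      (measurableT_comp mcf mshiftB)).
  - by move=> u w; rewrite mule_ge0.
transitivity (\int[P]_w \int[leb]_v (cut a (v + X w)%R * cut f v)).
  apply: eq_integral => w _.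
  rewrite -[RHS](integral_lebesgue_shift (- X w)%R); last 2 first.
    - apply: emeasurable_funM => //; apply: (measurableT_comp mca).
      exact: measurable_funD.
    - by move=> v; rewrite mule_ge0.
  by apply: eq_integral => u _; rewrite subrK.
rewrite -(@tonelli _ _ _ _ _ leb P (fun v w => cut a (v + X w)%R * cut f v));
  last 2 first.
  - exact: (emeasurable_funM (measurableT_comp mca mshiftD)
      (measurableT_comp mcf measurable_fst)).
  - by move=> u w; rewrite mule_ge0.
apply: eq_integral => v _; rewrite cut_mulr ge0_integralZr//.
exact: mcutD.
Qed.

(** Moving the killed steps to the other side of the pairing leaves n only in a
    factor with values in [0, 1]. *)
Lemma integral_passage h n : measurable_fun setT h -> (forall u, 0 <= h u) ->
  \int[leb]_u cut (passage h n) u =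
  \int[leb]_v cut (fun v => survival n v * transition h v) v.
Proof.
move=> mh h0.
(* j counts the steps that have been moved. *)
suff H j : \int[leb]_u cut (fun u => survival j u * passage h n u) u =
    \int[leb]_v cut (fun v => survival (j + n) v * transition h v) v.
  by rewrite -(H 0%N); apply: eq_integral => u _; rewrite cut_mulr mul1e.
elim: n j => [|n ih] j; first by rewrite addn0.
rewrite addnS -addSn -ih; exact: (transition_duality (@measurable_survival j)
  (survival_ge0 j) (measurable_passage n mh h0) (passage_ge0 n h0)).
Qed.

(** The assumption drift makes V a Lyapunov function: a step of the killed
    reversed walk decreases it by e on average. *)
Section drift.
Variables (V : R -> R) (e : R).
Hypothesis mV : measurable_fun setT V.
Hypothesis V0 : forall v, (0 <= v)%R -> (0 <= V v)%R.
Hypothesis e0 : (0 < e)%R.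
Hypothesis drift : forall v, (0 <= v)%R ->
  cotransition (EFin \o V) v + e%:E <= (V v)%:E.

Let cutV0 v : 0 <= cut (EFin \o V) v.
Proof. by rewrite /cut; case: ifP => // v0; rewrite lee_fin V0. Qed.

(** Each step survived costs e on average, and V stays nonnegative as long as
    the walk does: the mean total cost, which is at least n * e times the
    probability of surviving n steps, is at most V v. *)
Lemma survival_drift n v : (0 <= v)%R ->
  (n%:R * e)%:E * survival n v <= (V v)%:E.
Proof.
elim: n v => [|n ih] v v0; first by rewrite mul0r mul0e lee_fin V0.
apply: le_trans (drift v0).
rewrite -natr1 mulrDl mul1r EFinD ge0_muleDl ?lee_fin ?mulr_ge0 ?(ltW e0)//.
apply: leeD; last first.
  rewrite -[leRHS]mule1; apply: lee_wpmul2l; first by rewrite lee_fin ltW.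
  exact: (survival_le1 n.+1).
rewrite /= /cotransition -ge0_integralZl//=; last 3 first.
  - exact: (mcutD v (measurable_survival n)).
  - by move=> w _; apply: cut_ge0; exact: survival_ge0.
  - by rewrite lee_fin mulr_ge0// ltW.
apply: ge0_le_integral => //.
- move=> w _; rewrite mule_ge0 ?lee_fin ?mulr_ge0 ?(ltW e0)//.
  by apply: cut_ge0; exact: survival_ge0.
- by apply: emeasurable_funM => //; exact: (mcutD v (measurable_survival n)).
- by apply: mcutD; exact/measurable_EFinP.
- move=> w _; rewrite /cut; case: ifPn => [vX0|_]; last by rewrite mule0.
  exact: ih.
Qed.

Lemma survival_cvg0 v : (0 <= v)%R -> survival n v @[n --> \oo] --> 0.
Proof.
move=> v0.
suff: survival n.+1 v @[n --> \oo] --> 0 by rewrite (cvg_shiftS (survival^~ v)).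
apply: (@squeeze_cvge _ _ eventually_filter R (cst 0) _
  (fun n => (V v / e * harmonic n)%R%:E)).
- near=> n; apply/andP; split; first exact: survival_ge0.
  have fs : survival n.+1 v \is a fin_num.
    rewrite ge0_fin_numE ?survival_ge0//.
    by rewrite (le_lt_trans (survival_le1 _ _))// ltry.
  have := survival_drift n.+1 v0.
  rewrite -[survival n.+1 v](fineK fs) -EFinM !lee_fin => sV.
  by rewrite /harmonic/= ler_pdivlMr// ler_pdivlMr// -mulrA mulrC.
- exact: cvg_cst.
- apply: cvg_EFin; first exact: nearW.
  rewrite -[X in _ --> X](mulr0 (V v / e)%R).
  by apply: cvgMr; exact: cvg_harmonic.
Unshelve. all: by end_near. Qed.

(** Dominated convergence: after integral_passage, the integrand is transition h
    times a factor that is at most 1 and tends to 0. *)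
Lemma passage_cvg0 h : measurable_fun setT h -> (forall u, 0 <= h u) ->
  \int[leb]_v cut (transition h) v < +oo ->
  \int[leb]_u cut (passage h n) u @[n --> \oo] --> 0.
Proof.
move=> mh h0 hoo.
have mg : measurable_fun setT (cut (transition h)).
  exact: (measurable_cut (measurable_transition mh h0)).
have g0 : forall v, 0 <= cut (transition h) v.
  by apply: cut_ge0; exact: transition_ge0.
have ig : leb.-integrable setT (cut (transition h)).
  apply/integrableP; split => //.
  by under eq_integral do rewrite gee0_abs//.
have [] := @dominated_convergence _ _ _ leb setT measurableT
    (fun n v => survival n v * cut (transition h) v) (cst 0)
    (cut (transition h)).
- move=> n; apply: emeasurable_funM => //; exact: measurable_survival.
- exact: measurable_cst.
(* Where transition h is infinite the product need not tend to 0, but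
   integrability makes this a null set. *)
- have [N [mN N0 fN]] := integrable_ae measurableT ig.
  exists N; split => // v /= nv; apply: fN => /= fv; apply: nv => _.
  rewrite -(mul0e (cut (transition h) v)); have [v0|v0] := leP 0%R v.
    by apply: cvgeZr; [exact: fv|exact: survival_cvg0].
  by rewrite cut_neg// mule0; under eq_fun do rewrite mule0; exact: cvg_cst.
- exact: ig.
- apply: nearW => v n _; rewrite gee0_abs ?mule_ge0 ?survival_ge0//.
  rewrite -[leRHS]mul1e lee_wpmul2r ?survival_le1//.
- move=> _ _; rewrite integral0; apply: cvg_trans; apply: near_eq_cvg.
  apply: nearW => n; rewrite integral_passage//=.
  by apply: eq_integral => v _; rewrite cut_mulr.
Qed.

End drift.

End killed_walk.

(** * First passage of a walk with exponential upward steps *)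

Section exponential_walk.
Context {R : realType} {d : measure_display} {Omega : measurableType d}.
Variables (P : probability Omega R) (X Y : Omega -> R) (m : R).
Hypothesis mX : measurable_fun setT X.
Hypothesis mY : measurable_fun setT Y.
Hypothesis m0 : (0 < m)%R.
Local Notation leb := (@lebesgue_measure R).
Local Notation pdf := (exponential_pdf m).
Local Open Scope ereal_scope.
Hypothesis lawX : forall h : R -> \bar R,
  measurable_fun setT h -> (forall x, 0 <= h x) ->
  \int[P]_w h (X w) = \int[P]_w \int[leb]_s (h (Y w - s)%R * (pdf s)%:E).
Hypothesis Y0 : {ae P, forall w, (0 <= Y w)%R}.
Implicit Types f h : R -> \bar R.

Let mpdf : measurable_fun setT (EFin \o pdf).
Proof. by apply/measurable_EFinP; exact: measurable_exponential_pdf. Qed.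

Let pdf0 s : 0 <= (pdf s)%:E.
Proof. by rewrite lee_fin exponential_pdf_ge0// ltW. Qed.

Let mshift : measurable_fun setT (fun p : R * Omega => (p.1 - Y p.2)%R).
Proof.
exact: (measurable_funB measurable_fst (measurableT_comp mY measurable_snd)).
Qed.

(** The measure of the value u - Y after a claim, when the reserve u before the
    claim is spread over the half-line according to Lebesgue measure. *)
Definition overshoot h : \bar R :=
  \int[P]_w \int[leb]_u cut (fun u => h (u - Y w)%R) u.

Lemma transitionE h u : measurable_fun setT h -> (forall x, 0 <= h x) ->
  transition P X h u =
  \int[P]_w \int[leb]_s (h (u + s - Y w)%R * (pdf s)%:E).
Proof.
move=> mh h0; rewrite /transition (lawX (h := fun x => h (u - x)%R))//.
  apply: eq_integral => w _; apply: eq_integral => s _.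
  by rewrite opprB addrA.
by apply: (measurableT_comp mh); exact: measurable_funB.
Qed.

(** This is exponential_renewal for h shifted by Y, averaged over Y. *)
Lemma transition_renewal h : measurable_fun setT h -> (forall x, 0 <= h x) ->
  transition P X h 0 + m%:E * \int[leb]_u cut (transition P X h) u =
  m%:E * overshoot h.
Proof.
move=> mh h0.
pose k u w := \int[leb]_s (h (u + s - Y w)%R * (pdf s)%:E).
have k0 u w : 0 <= k u w by apply: integral_ge0 => s _; rewrite mule_ge0.
have mk : measurable_fun setT (fun p : R * Omega => k p.1 p.2).
  apply: (measurable_fun_fubini_tonelli_F (m2 := leb)
    (fun q : (R * Omega) * R =>
       h (q.1.1 + q.2 - Y q.1.2)%R * (pdf q.2)%:E)); last first.
    by move=> q; rewrite mule_ge0.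
  have m11 := measurableT_comp measurable_fst measurable_fst.
  have m12 := measurableT_comp measurable_snd measurable_fst.
  apply: emeasurable_funM; last exact: (measurableT_comp mpdf measurable_snd).
  apply: (measurableT_comp mh); apply: measurable_funB.
    by apply: measurable_funD; [exact: m11|exact: measurable_snd].
  by apply: (measurableT_comp mY); exact: m12.
have mk0 : measurable_fun setT (k 0%R).
  exact: (@measurable_fun_pair2 _ _ _ R Omega _ (fun p => k p.1 p.2) 0%R mk).
have mhY : measurable_fun setT (fun p : R * Omega => h (p.1 - Y p.2)%R).
  exact: (measurableT_comp mh mshift).
have mcutY : measurable_fun setT
    (fun p : R * Omega => cut (fun u => h (u - Y p.2)%R) p.1).
  apply: measurable_fun_ifT => //.
  exact: (measurable_fun_ler (measurable_cst _) measurable_fst).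
have mcutk : measurable_fun setT (fun p : R * Omega => cut (k^~ p.2) p.1).
  apply: measurable_fun_ifT => //.
  exact: (measurable_fun_ler (measurable_cst _) measurable_fst).
have -> : \int[leb]_u cut (transition P X h) u =
    \int[P]_w \int[leb]_u cut (k^~ w) u.
  rewrite -(@tonelli _ _ _ _ _ leb P (fun u w => cut (k^~ w) u))//; last first.
    by move=> u w; apply: cut_ge0 => v.
  apply: eq_integral => u _; rewrite /cut; case: ifP => // _.
    exact: transitionE.
  by rewrite integral0.
rewrite transitionE// /overshoot -!ge0_integralZl//=; last 6 first.
- apply: (measurable_fun_fubini_tonelli_G (m1 := leb) _ mcutY) => p.
  by apply: cut_ge0.
- by move=> w _; apply: integral_ge0 => u _; apply: cut_ge0.
- by rewrite lee_fin ltW.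
- apply: (measurable_fun_fubini_tonelli_G (m1 := leb) _ mcutk) => p.
  by apply: cut_ge0 => u.
- by move=> w _; apply: integral_ge0 => u _; apply: cut_ge0 => v.
- by rewrite lee_fin ltW.
rewrite -ge0_integralD; [|by []|by move=> w _; exact: k0|exact: mk0| |];
  last 2 first.
- move=> w _; rewrite mule_ge0 ?lee_fin ?(ltW m0)//; apply: integral_ge0 => u _.
  by apply: cut_ge0 => v.
- apply: emeasurable_funM => //.
  apply: (measurable_fun_fubini_tonelli_G (m1 := leb) _ mcutk) => p.
  by apply: cut_ge0 => u.
apply: eq_integral => w _.
rewrite -(exponential_renewal m0 (h := fun s => h (s - Y w)%R))//.
  by under eq_integral do rewrite add0r.
by apply: (measurableT_comp mh); exact: measurable_funB.
Qed.

(** Shifted by a nonnegative Y, the half-line still covers the half-line. *)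
Lemma overshoot_cut f : measurable_fun setT f -> (forall u, 0 <= f u) ->
  overshoot (cut f) = \int[leb]_u cut f u.
Proof.
move=> mf f0; have mcf := measurable_cut mf; have cf0 := cut_ge0 f0.
have mcut : measurable_fun setT
    (fun p : R * Omega => cut (fun u => cut f (u - Y p.2)%R) p.1).
  apply: measurable_fun_ifT => //; last exact: (measurableT_comp mcf mshift).
  exact: (measurable_fun_ler (measurable_cst _) measurable_fst).
have -> : overshoot (cut f) = \int[P]_w cst (\int[leb]_u cut f u) w.
  apply: ge0_ae_eq_integral => //.
  - by apply: (measurable_fun_fubini_tonelli_G (m1 := leb) _ mcut) => p;
      exact: cut_ge0.
  - by move=> w _; apply: integral_ge0 => u _; exact: cut_ge0.
  - by move=> w _; exact: integral_ge0.
  have [N [mN N0 YN]] := Y0.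
  exists N; split => // w /= nw; apply: YN => /= Yw; apply: nw => _.
  rewrite -(integral_lebesgue_shift (Y w)); last 2 first.
  - apply: measurable_cut; apply: (measurableT_comp mcf).
    exact: measurable_funB.
  - by apply: cut_ge0.
  apply: eq_integral => v _; rewrite /cut addrK.
  have [v0|] := boolP (0 <= v)%R; last by case: ifP.
  by rewrite addr_ge0.
exact: integral_probability_cst.
Qed.

(** By transition_renewal and overshoot_cut, the remainder of rank n is the term
    of rank n.+1 plus the remainder of rank n.+1. *)
Lemma sum_passage h n : measurable_fun setT h -> (forall x, 0 <= h x) ->
  \sum_(k < n.+1) passage P X h k 0%R
    + m%:E * \int[leb]_u cut (passage P X h n) u = m%:E * overshoot h.
Proof.
move=> mh h0; elim: n => [|n ih].
  by rewrite big_ord_recl big_ord0 adde0; exact: transition_renewal.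
have mp := measurable_passage P mX n mh h0; have p0 := passage_ge0 P X n h0.
rewrite big_ord_recr/= -addeA -ih; congr (_ + _).
rewrite -overshoot_cut// -transition_renewal//; last exact: cut_ge0.
exact: measurable_cut.
Qed.

Section net_profit.
Hypothesis net : \int[P]_w (Y w)%:E < (m^-1)%:E.

(** Up to the factor m, this is the renewal function 1 + m * v of the
    exponential law. *)
Let V (v : R) := (v + m^-1)%R.

(** Subtracting an exponential variable and killing below 0 undoes the addition
    of 1 / m: exponential_renewal for the indicator of (-oo, z]. *)
Lemma integral_V (z : R) : (0 <= z)%R ->
  \int[leb]_s (cut (EFin \o V) (z - s)%R * (pdf s)%:E) = z%:E.
Proof.
move=> z0.
pose h s : \bar R := if (s <= z)%R then 1 else 0.
have h0 s : 0 <= h s by rewrite /h; case: ifP.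
have mh : measurable_fun setT h.
  by apply: measurable_fun_ifT => //; exact: measurable_fun_ler.
have lenh y : \int[leb]_u cut (fun u => h (u + y)%R) u =
    if (0 <= z - y)%R then (z - y)%:E else 0.
  transitivity (\int[leb]_u (\1_(`[0%R, (z - y)%R]%classic : set R) u)%:E).
    apply: eq_integral => u _; rewrite /cut /h indicE mem_setE in_itv/=.
    by rewrite -lerBrDr; case: (0 <= u)%R => //=; case: (u <= z - y)%R.
  rewrite integral_indic// setIT [LHS](lebesgue_measure_itv `[0%R, (z - y)%R])/=
    lte_fin -EFinB subr0.
  by case: ltgtP => // <-.
have lenh0 y : 0 <= \int[leb]_u cut (fun u => h (u + y)%R) u.
  by apply: integral_ge0 => u _; exact: cut_ge0.
have mhD : measurable_fun setT (fun p : R * R => h (p.1 + p.2)%R).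
  exact: (measurableT_comp mh (measurable_funD measurable_fst measurable_snd)).
have mch : measurable_fun setT (fun p : R * R =>
    cut (fun u => h (u + p.2)%R) p.1 * (pdf p.2)%:E).
  apply: emeasurable_funM; last exact: (measurableT_comp mpdf measurable_snd).
  apply: measurable_fun_ifT => //.
  exact: (measurable_fun_ler (measurable_cst _) measurable_fst).
have mlen : measurable_fun setT
    (fun y => \int[leb]_u cut (fun u => h (u + y)%R) u).
  apply: (measurable_fun_fubini_tonelli_G (m1 := leb)
    (fun p : R * R => cut (fun u => h (u + p.2)%R) p.1)); last first.
    by move=> p; apply: cut_ge0.
  apply: measurable_fun_ifT => //.
  exact: (measurable_fun_ler (measurable_cst _) measurable_fst).
have mE0 : 0 <= m%:E by rewrite lee_fin ltW.
have mcV : measurable_fun setT (cut (EFin \o V)).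
  by apply: measurable_cut; apply/measurable_EFinP; exact: measurable_funD.
have cV0 u : 0 <= cut (EFin \o V) u.
  rewrite /cut; case: ifP => // u0; rewrite lee_fin addr_ge0// invr_ge0.
  exact: ltW.
apply: (mule_pI m0).
transitivity (m%:E * \int[leb]_u cut h u); last first.
  have := lenh 0%R; rewrite subr0 z0 => <-; congr (_ * _).
  by apply: eq_integral => u _; rewrite /cut addr0.
rewrite -(exponential_renewal m0 mh h0).
have -> : \int[leb]_u cut (fun u => \int[leb]_s (h (u + s)%R * (pdf s)%:E)) u
    = \int[leb]_s ((\int[leb]_u cut (fun u => h (u + s)%R) u) * (pdf s)%:E).
  transitivity (\int[leb]_s \int[leb]_u
      (cut (fun u => h (u + s)%R) u * (pdf s)%:E)); last first.
    apply: eq_integral => s _; rewrite ge0_integralZr//.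
    - apply: measurable_cut; apply: (measurableT_comp mh).
      exact: measurable_funD.
    - by move=> u _; exact: cut_ge0.
  rewrite -(@tonelli _ _ _ _ _ leb leb (fun u s =>
    cut (fun u => h (u + s)%R) u * (pdf s)%:E))//; last first.
    by move=> u s; rewrite mule_ge0//; exact: cut_ge0.
  apply: eq_integral => u _; rewrite /cut; case: ifP => // _.
  by under eq_integral do rewrite mul0e; rewrite integral0.
rewrite -ge0_integralZl//; last 2 first.
- apply: emeasurable_funM => //; apply: (measurableT_comp mcV).
  exact: measurable_funB.
- by move=> s _; rewrite mule_ge0.
rewrite -ge0_integralZl//; last 2 first.
- exact: emeasurable_funM.
- by move=> s _; rewrite mule_ge0.
rewrite -ge0_integralD//; last 4 first.
- by move=> s _; rewrite mule_ge0.
- exact: emeasurable_funM.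
- by move=> s _; rewrite !mule_ge0.
- by apply: emeasurable_funM => //; exact: emeasurable_funM.
apply: eq_integral => s _; rewrite lenh !muleA -ge0_muleDl//; last first.
  by rewrite mule_ge0//; case: ifP.
congr (_ * _); rewrite /cut /h subr_ge0; case: ifP => [sz|_]; last first.
  by rewrite !mule0 adde0.
by rewrite -EFinM -EFinD /V mulrDr divff ?gt_eqF// addrC.
Qed.

Let EY := \int[P]_w (Y w)%:E.

(** After the claim the reversed walk is at v + Y >= 0, and integral_V evaluates
    the exponential part of the step. Since V v = v + 1 / m, the drift of V is
    E Y - 1 / m, which is negative under the net profit condition. *)
Lemma cotransition_V v : (0 <= v)%R ->
  cotransition P X (EFin \o V) v = v%:E + EY.
Proof.
move=> v0.
have mcV : measurable_fun setT (cut (EFin \o V)).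
  by apply: measurable_cut; apply/measurable_EFinP; exact: measurable_funD.
have cV0 u : 0 <= cut (EFin \o V) u.
  rewrite /cut; case: ifP => // u0; rewrite lee_fin addr_ge0// invr_ge0.
  exact: ltW.
pose Y' w := Num.max 0%R (Y w).
have mY' : measurable_fun setT Y' by exact: measurable_maxr.
have Y'0 w : (0 <= Y' w)%R by rewrite le_max lexx.
have YY' : {ae P, forall w, Y w = Y' w}.
  by apply: filterS Y0 => w Yw; rewrite /Y' max_r.
have -> : EY = \int[P]_w (Y' w)%:E.
  apply: ae_eq_integral => //; [exact/measurable_EFinP|exact/measurable_EFinP|].
  by apply: filterS YY' => w -> _.
rewrite -{1}(integral_probability_cst P v%:E) -ge0_integralD//; last 2 first.
- by move=> w _; rewrite lee_fin.
- exact/measurable_EFinP.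
rewrite /cotransition (lawX (h := fun x => cut (EFin \o V) (v + x)%R))//;
  last first.
  by apply: (measurableT_comp mcV); exact: measurable_funD.
apply: ge0_ae_eq_integral => //.
- apply: (measurable_fun_fubini_tonelli_F (m2 := leb) (fun p : Omega * R =>
    cut (EFin \o V) (v + (Y p.1 - p.2))%R * (pdf p.2)%:E)); last first.
    by move=> p; rewrite mule_ge0.
  apply: emeasurable_funM; last exact: (measurableT_comp mpdf measurable_snd).
  apply: (measurableT_comp mcV); apply: measurable_funD => //.
  exact: (measurable_funB (measurableT_comp mY measurable_fst) measurable_snd).
- by apply: emeasurable_funD => //; exact/measurable_EFinP.
- by move=> w _; apply: integral_ge0 => s _; rewrite mule_ge0.
- by move=> w _; rewrite adde_ge0// lee_fin.
apply: filterS YY' => w Yw _; rewrite -EFinD -integral_V ?addr_ge0//.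
by apply: eq_integral => s _; rewrite Yw addrA.
Qed.

(** The limit of sum_passage: the drift of V makes the remainder tend to 0. *)
Theorem ladder_sum h : measurable_fun setT h -> (forall x, 0 <= h x) ->
  overshoot h < +oo ->
  \sum_(0 <= k <oo) passage P X h k 0%R = m%:E * overshoot h.
Proof.
move=> mh h0 hoo.
have EY0 : 0 <= EY.
  rewrite -(integral_probability_cst P 0).
  rewrite (_ : EY = \int[P]_w (Num.max 0%R (Y w))%:E); last first.
    apply: ae_eq_integral => //; try exact/measurable_EFinP.
      by apply/measurable_EFinP; exact: measurable_maxr.
    by apply: filterS Y0 => w Yw _; rewrite max_r.
  apply: ge0_le_integral => //.
    by apply/measurable_EFinP; exact: measurable_maxr.
  by move=> w _; rewrite lee_fin le_max lexx.
have EYfin : EY \is a fin_num by rewrite ge0_fin_numE// (lt_trans net)// ltry.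
have mC := transition_renewal mh h0.
have moo : m%:E * overshoot h < +oo by rewrite lte_mul_pinfty// lee_fin ltW.
have g0 := transition_ge0 P X h0.
have cg0 : 0 <= \int[leb]_v cut (transition P X h) v.
  by apply: integral_ge0 => v _; exact: cut_ge0.
have goo : \int[leb]_v cut (transition P X h) v < +oo.
  rewrite ltey; apply/eqP => gy; move: moo; rewrite -mC gy gt0_muley ?lte_fin//.
  by rewrite addey ?ltxx// gt_eqF// (lt_le_trans _ (g0 0%R)).
have acvg : \int[leb]_u cut (passage P X h n) u @[n --> \oo] --> 0.
  apply: (@passage_cvg0 _ _ _ P X mX V (m^-1 - fine EY)%R) => //.
  - exact: measurable_funD.
  - by move=> v v0; rewrite addr_ge0// invr_ge0 ltW.
  - by rewrite subr_gt0 -lte_fin fineK.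
  - move=> v v0; rewrite cotransition_V// -(fineK EYfin) -!EFinD lee_fin /V.
    by rewrite /= addrA addrAC addrK.
have scvg : \sum_(k < n.+1) passage P X h k 0%R @[n --> \oo] -->
    \sum_(0 <= k <oo) passage P X h k 0%R.
  rewrite (_ : (fun n => \sum_(k < n.+1) passage P X h k 0%R) =
      (fun n => \sum_(0 <= k < n.+1) passage P X h k 0%R)); last first.
    by apply/funext => n; rewrite big_mkord.
  have : \sum_(0 <= k < n) passage P X h k 0%R @[n --> \oo] -->
    \sum_(0 <= k <oo) passage P X h k 0%R.
    by apply: is_cvg_nneseries => k _ _; exact: passage_ge0.
  by rewrite -(cvg_shiftS (fun n => \sum_(0 <= k < n) passage P X h k 0%R)).
have : \sum_(k < n.+1) passage P X h k 0%R
    + m%:E * \int[leb]_u cut (passage P X h n) u @[n --> \oo] -->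
    \sum_(0 <= k <oo) passage P X h k 0%R + m%:E * 0.
  apply: cvgeD => //; first by rewrite mule0 fin_num_adde_defl.
  exact: cvgeZl.
rewrite mule0 adde0; under eq_fun do rewrite sum_passage//.
by move=> /(cvg_unique _ (@cvg_cst _ _ _ _ _))<-.
Qed.

End net_profit.

End exponential_walk.

(** * Independence *)

Section independence_lemmas.
Context {d : measure_display} {T : measurableType d} {R : realType}.
Variable P : probability T R.
Implicit Types G H : set (set T).

Lemma independent2_sym G H : independent2 P G H -> independent2 P H G.
Proof. by move=> GH B A HB GA; rewrite setIC GH// muleC. Qed.

Lemma independent2_sub G G' H H' : G `<=` G' -> H `<=` H' ->
  independent2 P G' H' -> independent2 P G H.
Proof. by move=> GG' HH' i A B /GG' GA /HH' HB; exact: i. Qed.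

(** For B in H, the finite measures A |-> P (A `&` B) and A |-> P A * P B agree
    on the pi-system G, hence on the sigma-algebra that it generates. *)
Lemma independent2_g_sigma_l G H :
  G `<=` measurable -> G setT -> setI_closed G -> H `<=` measurable ->
  independent2 P G H -> independent2 P <<s G >> H.
Proof.
move=> Gm GT GI Hm GH A B sA HB; have mB := Hm _ HB.
have PB0 : (0 <= fine (P B))%R by exact: fine_ge0.
have PBE : (fine (P B))%:E = P B by rewrite fineK// fin_num_measure.
have mE C : mscale (NngNum PB0) P C = (P B * P C)%E by rewrite -[in RHS]PBE.
have H1 : mrestr P mB A = mscale (NngNum PB0) P A.
  apply: (g_sigma_algebra_measure_unique G Gm (fun=> setT)) => //.
  - by apply/seteqP; split => // x _; exists 0%N.
  - move=> C GC; apply: eq_trans (esym (mE C)); rewrite muleC; exact: GH.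
  - move=> k; rewrite /mrestr/=.
    apply: (@le_lt_trans _ _ 1%E); last exact: ltry.
    by apply: probability_le1; exact: measurableI.
by rewrite muleC; exact: eq_trans H1 (mE A).
Qed.

Lemma independent2_g_sigma G H :
  G `<=` measurable -> G setT -> setI_closed G ->
  H `<=` measurable -> H setT -> setI_closed H ->
  independent2 P G H -> independent2 P <<s G >> <<s H >>.
Proof.
move=> Gm GT GI Hm HT HI GH.
have sm (K : set (set T)) : K `<=` measurable -> <<s K >> `<=` measurable.
  by move=> Km; apply: smallest_sub => //; exact: sigma_algebra_measurable.
apply: independent2_g_sigma_l => //; first exact: sm.
by apply/independent2_sym/independent2_g_sigma_l => //; exact: independent2_sym.
Qed.

Section grouping.
Variables (I : eqType) (F : I -> set (set T)).
Hypothesis Fm : forall i, F i `<=` measurable.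
Hypothesis FT : forall i, F i setT.
Hypothesis FI : forall i, setI_closed (F i).
Hypothesis Findep : mutually_independent P F.
Implicit Types K : set I.

(** The finite intersections of events of the families indexed by K form a
    pi-system that generates the sigma-algebra of the block K. *)
Definition cylinders K : set (set T) := [set A | exists (J : seq I) E,
  [/\ uniq J, [set` J] `<=` K, forall i, i \in J -> F i (E i) &
      A = \bigcap_(i in [set` J]) E i]].

Lemma cylinders_measurable K : cylinders K `<=` measurable.
Proof.
move=> _ [J [E [_ _ FE ->]]]; apply: fin_bigcap_measurable => //.
by move=> i /= iJ; exact/Fm/FE.
Qed.

Lemma cylindersT K : cylinders K setT.
Proof.
by exists [::], (fun=> setT); split => //; rewrite set_nil bigcap_set0.
Qed.

Lemma sub_cylinders K i : K i -> F i `<=` cylinders K.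
Proof.
move=> Ki A FA; exists [:: i], (fun=> A); split => //.
- by move=> j /=; rewrite inE => /eqP ->.
- by move=> j; rewrite inE => /eqP ->.
- by apply/seteqP; split => x; [move=> Ax j _|apply; rewrite /= inE].
Qed.

Lemma cylindersI K : setI_closed (cylinders K).
Proof.
move=> _ _ [J [E [uJ JK FE ->]]] [J' [E' [uJ' J'K FE' ->]]].
exists (undup (J ++ J')), (fun i => (if i \in J then E i else setT) `&`
  (if i \in J' then E' i else setT)); split; first exact: undup_uniq.
- by move=> i /=; rewrite mem_undup mem_cat => /orP[/JK|/J'K].
- move=> i _; apply: FI; case: ifP => //; [exact: FE|exact: FE'].
- apply/seteqP; split => x.
    move=> [Jx J'x] i /=; rewrite mem_undup mem_cat => iJ; split.
      by case: ifP => // ?; exact: Jx.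
    by case: ifP => // ?; exact: J'x.
  move=> JJx; split => i /= iJ.
    have /JJx/= : i \in undup (J ++ J') by rewrite mem_undup mem_cat iJ.
    by rewrite iJ => -[].
  have /JJx/= : i \in undup (J ++ J') by rewrite mem_undup mem_cat iJ orbT.
  by rewrite iJ => -[].
Qed.

Lemma independent2_cylinders K K' : K `&` K' `<=` set0 ->
  independent2 P (cylinders K) (cylinders K').
Proof.
move=> KK' _ _ [J [E [uJ JK FE ->]]] [J' [E' [uJ' J'K FE' ->]]].
have JJ' i : i \in J' -> i \in J = false.
  move=> iJ'; apply/negP => iJ; apply: (KK' i).
  by split; [exact: JK|exact: J'K].
pose D i := if i \in J then E i else E' i.
have -> : \bigcap_(i in [set` J]) E i `&` \bigcap_(i in [set` J']) E' i =
    \bigcap_(i in [set` J ++ J']) D i.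
  apply/seteqP; split => x.
    move=> [Jx J'x] i /=; rewrite mem_cat /D => /orP[iJ|iJ'].
      by rewrite iJ; exact: Jx.
    by rewrite JJ'//; exact: J'x.
  move=> Dx; split => i /= iJ.
    by have := Dx i; rewrite /= mem_cat iJ /D iJ; exact.
  by have := Dx i; rewrite /= mem_cat iJ orbT /D JJ'//; exact.
rewrite Findep//; last 2 first.
- rewrite cat_uniq uJ uJ' andbT/=; apply/hasPn => i iJ' /=.
  by rewrite JJ'.
- move=> i; rewrite mem_cat /D => /orP[iJ|iJ']; first by rewrite iJ; exact: FE.
  by rewrite JJ'//; exact: FE'.
rewrite !Findep// big_cat/=; congr (_ * _)%E; apply: eq_big_seq => i iJ.
  by rewrite /D iJ.
by rewrite /D JJ'.
Qed.

Lemma independent2_grouping K K' : K `&` K' `<=` set0 ->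
  independent2 P <<s \bigcup_(i in K) F i >> <<s \bigcup_(i in K') F i >>.
Proof.
move=> KK'.
have sub K0 : <<s \bigcup_(i in K0) F i >> `<=` <<s cylinders K0 >>.
  apply: smallest_sub; first exact: smallest_sigma_algebra.
  by move=> A [i Ki FA]; apply: sub_sigma_algebra; exact: (sub_cylinders Ki FA).
apply: (independent2_sub (@sub K) (@sub K')).
apply: independent2_g_sigma; [exact: cylinders_measurable|exact: cylindersT|
  exact: cylindersI|exact: cylinders_measurable|exact: cylindersT|
  exact: cylindersI|exact: independent2_cylinders].
Qed.

End grouping.

(** When a finite intersection is grouped by rows, the independence of the rows
    splits it into rows, and the independence inside each row into cells. *)
Lemma mutually_independent_pairs (I1 : finType) (I2 : eqType)
    (F : I1 -> I2 -> set (set T)) :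
  (forall j, mutually_independent P (F j)) ->
  mutually_independent P (fun j => <<s \bigcup_(i in setT) F j i >>) ->
  mutually_independent P (fun p : I1 * I2 => F p.1 p.2).
Proof.
move=> Fj sF J E uJ FE.
pose Jof j := [seq p.2 | p <- J & p.1 == j].
pose E' j := \bigcap_(i in [set` Jof j]) E (j, i).
have JofP j i : (i \in Jof j) = ((j, i) \in J).
  apply/mapP/idP => [[[j' i']]|ji].
    by rewrite mem_filter/= => /andP[/eqP -> pJ] ->.
  by exists (j, i) => //; rewrite mem_filter/= eqxx.
have uJof j : uniq (Jof j).
  rewrite map_inj_in_uniq ?filter_uniq// => -[j1 i1] [j2 i2].
  by rewrite !mem_filter/= => /andP[/eqP -> _] /andP[/eqP -> _] ->.
have -> : \bigcap_(p in [set` J]) E p = \bigcap_(j in [set` enum I1]) E' j.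
  apply/seteqP; split => x Ex.
    by move=> j _ i /=; rewrite JofP => /Ex.
  move=> [j i] /= pJ; apply: (Ex j); first by rewrite /= mem_enum.
  by rewrite /= JofP.
rewrite sF ?enum_uniq//; last first.
  move=> j _; rewrite /E'.
  apply: (@fin_bigcap_measurable _
    (g_sigma_algebraType (\bigcup_(i in setT) F j i))) => // i /=.
  rewrite JofP => /FE/= FEi.
  by apply: sub_sigma_algebra; exists i.
rewrite big_enum/= (partition_big (fun p : I1 * I2 => p.1) xpredT)//=.
apply: eq_bigr => j _; rewrite /E' (Fj j)//; last first.
  by move=> i; rewrite JofP => /FE.
rewrite big_map big_filter.
by apply: eq_bigr => -[j' i] /eqP /= ->.
Qed.

End independence_lemmas.

Section independent_integral.
Context {R : realType} {d d1 d2 : measure_display} {T : measurableType d}.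
Context {U1 : measurableType d1} {U2 : measurableType d2}.
Variables (P : probability T R) (X1 : T -> U1) (X2 : T -> U2).
Hypothesis mX1 : measurable_fun setT X1.
Hypothesis mX2 : measurable_fun setT X2.
Hypothesis iX : independent2 P (sigma_rv X1) (sigma_rv X2).
Local Open Scope ereal_scope.

(** The joint law is the product of the marginals, by uniqueness of the product
    measure on rectangles; Fubini then integrates one variable at a time. *)
Lemma integral_independent (f : U1 -> U2 -> \bar R) :
  measurable_fun setT (fun p => f p.1 p.2) -> (forall x y, 0 <= f x y) ->
  \int[P]_w f (X1 w) (X2 w) = \int[P]_w \int[P]_w' f (X1 w) (X2 w').
Proof.
move=> mf f0.
have mX : measurable_fun setT (fun w => (X1 w, X2 w)).
  exact: measurable_fun_pair.
pose X1' : {RV P >-> U1} := mfun_Sub (mem_set mX1).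
pose X2' : {RV P >-> U2} := mfun_Sub (mem_set mX2).
pose X' : {RV P >-> (U1 * U2)%type} := mfun_Sub (mem_set mX).
pose g p := f p.1 p.2.
transitivity (\int[distribution P X']_p g p).
  by rewrite ge0_integral_distribution// => -[x y]; exact: f0.
transitivity (\int[distribution P X1' \x distribution P X2']_p g p).
  apply: eq_measure_integral => A mA _; apply/esym.
  apply: product_measure_unique => // B C mB mC.
  rewrite /distribution /pushforward.
  transitivity (P (X1 @^-1` B `&` X2 @^-1` C)) => //.
  by apply: iX; [exists B|exists C] => //; rewrite setTI.
have g0 p : 0 <= g p by exact: f0.
rewrite fubini_tonelli1//.
rewrite ge0_integral_distribution//; last 2 first.
- exact: measurable_fun_fubini_tonelli_F.
- by move=> x; exact: integral_ge0.
apply: eq_integral => w _; rewrite /= /fubini_F.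
rewrite ge0_integral_distribution//.
exact: (measurable_fun_pair2 (X1 w) mf).
Qed.

End independent_integral.

(** * The walk stopped at its first negative value *)

Section stopped_walk.
Context {R : realType} {d : measure_display} {Omega : measurableType d}.
Variables (P : probability Omega R) (X : nat -> Omega -> R).
Local Open Scope ereal_scope.

(** Negative values are absorbing, so that the depth of the first negative value
    can be read at any later time. *)
Fixpoint stopped n (w : Omega) : R :=
  if n is k.+1 then
    (if (0 <= stopped k w)%R then stopped k w - X k w else stopped k w)%R
  else 0%R.

(** For B a set of negative numbers: step k takes the walk below 0, into B. *)
Definition exit_at k (B : set R) : set Omega :=
  [set w | (0 <= stopped k w)%R /\ B (stopped k w - X k w)%R].

Lemma stopped_lt0 n k w : (n <= k)%N -> (stopped n w < 0)%R ->
  stopped k w = stopped n w.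
Proof.
move=> nk sn; elim: k nk => [|k ih]; first by rewrite leqn0 => /eqP ->.
rewrite leq_eqVlt => /predU1P[->//|/ih/= ->].
by rewrite leNgt sn.
Qed.

Lemma trivIset_exit_at B : B `<=` [set x | (x < 0)%R] ->
  trivIset setT (exit_at ^~ B).
Proof.
move=> Bneg; suff H i j : (i < j)%N -> exit_at i B `&` exit_at j B = set0.
  apply/trivIsetP => i j _ _; rewrite neq_ltn => /orP[/H//|/H].
  by rewrite setIC.
move=> ij; apply/seteqP; split => // w [[si BX] [sj _]].
have sSi : (stopped i.+1 w < 0)%R by rewrite /= si; exact: Bneg.
by move: sj; rewrite (stopped_lt0 ij sSi) leNgt sSi.
Qed.

Hypothesis mX : forall k, measurable_fun setT (X k).

Lemma measurable_stopped k : measurable_fun setT (stopped k).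
Proof.
elim: k => [|k ih]; first exact: measurable_cst.
by apply: measurable_fun_ifT => //; [exact: measurable_fun_ler|
  exact: measurable_funB].
Qed.

Lemma measurable_exit_at k B : measurable B -> measurable (exit_at k B).
Proof.
move=> mB; rewrite (_ : exit_at k B = stopped k @^-1` `[0%R, +oo[ `&`
  (fun w => stopped k w - X k w)%R @^-1` B); last first.
  by apply/seteqP; split => w [w1 w2]; split=> //; move: w1;
    rewrite /= in_itv/= andbT.
have ms := @measurable_stopped k.
apply: measurableI; rewrite -[X in measurable X]setTI; first exact: ms.
exact: (measurable_funB ms (mX k)).
Qed.

Hypothesis indepX :
  forall k, independent2 P (sigma_rv (stopped k)) (sigma_rv (X k)).
Hypothesis idX : forall k, same_law P (X k) P (X 0%N).

Lemma same_law_integral (k : nat) (h : R -> \bar R) :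
  measurable_fun setT h -> (forall x, 0 <= h x) ->
  \int[P]_w h (X k w) = \int[P]_w h (X 0%N w).
Proof.
move=> mh h0; pose Z j : {RV P >-> R} := mfun_Sub (mem_set (mX j)).
transitivity (\int[distribution P (Z k)]_x h x).
  by rewrite ge0_integral_distribution.
transitivity (\int[distribution P (Z 0%N)]_x h x).
  by apply: eq_measure_integral => A mA _; exact: idX.
by rewrite ge0_integral_distribution.
Qed.

Lemma integral_stopped_step k (h : R -> \bar R) :
  measurable_fun setT h -> (forall x, 0 <= h x) ->
  \int[P]_w cut (fun v => h (v - X k w)%R) (stopped k w) =
  \int[P]_w cut (transition P (X 0%N) h) (stopped k w).
Proof.
move=> mh h0; have ms := @measurable_stopped k.
rewrite (integral_independent ms (mX k) (@indepX k)
  (f := fun v x => cut (fun v => h (v - x)%R) v)); last 2 first.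
- apply: measurable_fun_ifT => //.
    exact: (measurable_fun_ler (measurable_cst _) measurable_fst).
  exact: (measurableT_comp mh (measurable_funB measurable_fst measurable_snd)).
- by move=> v x; exact: cut_ge0.
apply: eq_integral => w _; rewrite /cut; case: ifP => _; last first.
  by rewrite integral0.
apply: (@same_law_integral k (fun x => h (stopped k w - x)%R)) => //.
by apply: (measurableT_comp mh); exact: measurable_funB.
Qed.

(** The position before each step is independent of the step, so that the law of
    the stopped walk on the half-line is given by iterated killed steps. *)
Lemma integral_stopped k (f : R -> \bar R) :
  measurable_fun setT f -> (forall x, 0 <= f x) ->
  \int[P]_w cut f (stopped k w) =
  iter k (fun f => transition P (X 0%N) (cut f)) f 0%R.
Proof.
elim: k f => [|k ih] f mf f0.
  by rewrite /= cut_pos//; exact: (integral_probability_cst P (f 0%R)).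
have mcf := measurable_cut mf; have cf0 := cut_ge0 f0.
rewrite iterSr -ih; last 2 first.
- exact: measurable_transition.
- exact: transition_ge0.
rewrite -integral_stopped_step//; apply: eq_integral => w _.
rewrite /=; case: ifPn => [s0|]; first by rewrite [RHS]cut_pos.
by rewrite -ltNge => s0; rewrite !cut_neg.
Qed.

(** The walk exits at most once, and by independence the probability that it
    exits at step k is a passage term. *)
Lemma probability_exit (B : set R) : measurable B ->
  B `<=` [set x | (x < 0)%R] ->
  P (\bigcup_k exit_at k B) =
  \sum_(0 <= k <oo) passage P (X 0%N) (EFin \o \1_B) k 0%R.
Proof.
move=> mB Bneg.
have h0 x : 0 <= (EFin \o (\1_B : R -> R)) x by rewrite lee_fin.
have mh : measurable_fun setT (EFin \o (\1_B : R -> R)).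
  exact/measurable_EFinP.
rewrite measure_bigcup//; last 2 first.
- by move=> k _; exact: measurable_exit_at.
- exact: trivIset_exit_at.
rewrite (eq_eseriesl (Q := xpredT)); last by move=> i; rewrite in_setT.
apply: eq_eseriesr => k _.
have mg := measurable_transition P (mX 0%N) mh h0.
rewrite /passage -integral_stopped//; last exact: transition_ge0.
rewrite -integral_stopped_step//.
transitivity (\int[P]_w (\1_(exit_at k B) w)%:E).
  by rewrite integral_indic ?setIT//; exact: measurable_exit_at.
apply: eq_integral => w _; rewrite /cut /exit_at indicE.
case: ifPn => s0; last by rewrite memNset// => -[]; rewrite (negPf s0).
by rewrite /= indicE; congr (_%:R)%:E; congr nat_of_bool; apply/idP/idP;
  rewrite !inE => //= -[].
Qed.

End stopped_walk.

(** * Ruin as a first passage *)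

Section ruin_paths.
Context {R : realType} {d : measure_display} {Omega : measurableType d}.
Variables (c : R) (N : R -> Omega -> nat) (S Y : nat -> Omega -> R).
Hypothesis c0 : 0 < c.
Hypothesis S0 : forall n w, 0 < S n w.
Hypothesis NS :
  forall t w n, 0 <= t -> (n <= N t w)%N = (\sum_(k < n) S k w <= t).

Let X k w := Y k w - c * S k w.
Let A n w := \sum_(k < n) S k w.
Let W n w := \sum_(k < n) X k w.

Let AS n w : A n.+1 w = A n w + S n w.
Proof. by rewrite /A big_ord_recr. Qed.

Let A0 n w : 0 <= A n w.
Proof. by apply: sumr_ge0 => k _; exact: ltW. Qed.

Let WE n w : W n w = \sum_(k < n) Y k w - c * A n w.
Proof. by rewrite /W /X big_split/= sumrN mulr_sumr. Qed.

Lemma counting_uniq t w n : A n w <= t < A n.+1 w -> N t w = n.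
Proof.
move=> /andP[nt tn]; have t0 := le_trans (A0 n w) nt.
apply/eqP; rewrite eqn_leq (NS _ _ t0) nt andbT leqNgt (NS _ _ t0).
by rewrite -ltNge.
Qed.

Lemma reserveE t w n : A n w <= t < A n.+1 w ->
  reserve c N Y t w = c * (t - A n w) - W n w.
Proof. by move=> /counting_uniq tn; rewrite /reserve tn WE; ring. Qed.

Lemma arrivals_cover t w : 0 <= t -> A (N t w) w <= t < A (N t w).+1 w.
Proof. by move=> t0; rewrite -(NS _ _ t0) leqnn/= ltNge -(NS _ _ t0) ltnn. Qed.

Lemma stopped_survived k w : (forall j, (j <= k)%N -> W j w <= 0) ->
  stopped X k w = - W k w.
Proof.
elim: k => [|k ih] Wle; first by rewrite /= /W big_ord0 oppr0.
rewrite /= ih => [|j jk]; last by apply: Wle; exact: leqW.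
by rewrite oppr_ge0 Wle ?leqnSn// /W big_ord_recr/= [RHS]opprD.
Qed.

Lemma survived_stopped k w : 0 <= stopped X k w ->
  forall j, (j <= k)%N -> W j w <= 0.
Proof.
move=> sk; elim/ltn_ind => j ih jk.
have sj : 0 <= stopped X j w.
  rewrite leNgt; apply/negP => sj.
  by move: sk; rewrite (stopped_lt0 jk sj) leNgt sj.
case: j ih jk sj => [|j] ih jk sj; first by rewrite /W big_ord0.
have Wj i : (i <= j)%N -> W i w <= 0.
  by move=> ij; apply: ih => //; exact: leq_trans (leqW ij) jk.
suff E : stopped X j.+1 w = - W j.+1 w by rewrite E oppr_ge0 in sj.
by rewrite /= stopped_survived// oppr_ge0 Wj// /W big_ord_recr/= [RHS]opprD.
Qed.

Lemma exit_walk k w : exit_at X k [set x | x < 0] w ->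
  (forall j, (j <= k)%N -> W j w <= 0) /\
  stopped X k w - X k w = - W k.+1 w.
Proof.
move=> [sk /= _]; have Wk := survived_stopped sk; split => //.
by rewrite stopped_survived// /W big_ord_recr/= [RHS]opprD.
Qed.

(** Between arrivals the reserve increases from a nonnegative value. It is
    therefore nonnegative until the jump of step k, which takes place at the
    end of the gap k, that is, at the epoch A k.+1. *)
Lemma ruin_time_exit k w : exit_at X k [set x | x < 0] w ->
  ruin_time c N Y w = (A k.+1 w)%:E.
Proof.
move=> ex; have [Wk sX] := exit_walk ex; have [_ /=] := ex; rewrite sX => Wneg.
have Ak : A k.+1 w < A k.+2 w by rewrite [ltRHS]AS ltrDl.
apply/eqP; rewrite eq_le; apply/andP; split.
  apply: ereal_inf_lbound; exists (A k.+1 w) => //; split.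
    by rewrite AS ltr_wpDl.
  by rewrite (@reserveE _ _ k.+1) ?lexx// subrr mulr0 sub0r.
apply: le_ereal_inf_tmp => _ [t [t0 rt] <-]; rewrite lee_fin.
have := arrivals_cover w (ltW t0); move: (N t w) => n nt.
have [kn|nk] := ltnP k n.
  case/andP: nt => + _; apply: le_trans.
  rewrite /A -(subnKC kn) big_split_ord/= lerDl.
  by apply: sumr_ge0 => i _; exact: ltW.
move: rt; rewrite (reserveE nt) ltNge => /negP[].
rewrite subr_ge0 (le_trans (Wk n nk))// mulr_ge0 ?(ltW c0)// subr_ge0.
by case/andP: nt.
Qed.

(** The reserve is affine to the right of the arrival epoch, so that the limit
    there is its value just after the claim. *)
Lemma deficit_exit k w : exit_at X k [set x | x < 0] w ->
  deficit c N Y w = - (stopped X k w - X k w).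
Proof.
move=> ex; have [Wk sX] := exit_walk ex.
rewrite sX /deficit (ruin_time_exit ex)/=; congr (- _).
have Ak : A k.+1 w < A k.+2 w by rewrite [ltRHS]AS ltrDl.
apply/cvg_lim => //.
have : c * (t - A k.+1 w) - W k.+1 w @[t --> (A k.+1 w)^'+] -->
    c * (A k.+1 w - A k.+1 w) - W k.+1 w.
  apply: cvgB; last exact: cvg_cst.
  apply: cvgM; first exact: cvg_cst.
  by apply: cvgB; [exact: cvg_at_right_filter cvg_id|exact: cvg_cst].
rewrite subrr mulr0 sub0r; apply: cvg_trans; apply: near_eq_cvg.
near=> t; apply/esym/reserveE; apply/andP; split.
  by apply/ltW; near: t; exact: nbhs_right_gt.
by near: t; exact: nbhs_right_lt.
Unshelve. all: by end_near. Qed.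

(** At a time when the reserve is negative the walk W is positive, and the exit
    happens at the least n such that W n is positive. *)
Lemma ruin_exit w : ruin c N Y w -> exists k, exit_at X k [set x | x < 0] w.
Proof.
move=> /ereal_inf_lt[_ [t [t0 rt] <-] _].
have nt := arrivals_cover w (ltW t0); move: (N t w) nt => n nt.
have Wn : 0 < W n w.
  move: rt; rewrite (reserveE nt) subr_lt0; apply: le_lt_trans.
  by case/andP: nt => An _; rewrite mulr_ge0 ?(ltW c0)// subr_ge0.
have exW : exists n, 0 < W n w by exists n.
case: (ex_minnP exW) => -[|k]; first by rewrite /W big_ord0 ltxx.
move=> Wk Wmin; exists k.
have Wle j : (j <= k)%N -> W j w <= 0.
  by move=> jk; rewrite leNgt; apply/negP => /Wmin; rewrite ltnNge jk.
split; first by rewrite stopped_survived// oppr_ge0 Wle.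
suff E : stopped X k w - X k w = - W k.+1 w by rewrite /= E oppr_lt0.
by rewrite stopped_survived// /W big_ord_recr/= [RHS]opprD.
Qed.

Lemma ruin_deficitE (D : set R) : deficit c N Y @^-1` D `&` ruin c N Y =
  \bigcup_k exit_at X k [set x | x < 0 /\ D (- x)].
Proof.
apply/seteqP; split => w.
  move=> [Dw /ruin_exit[k ex]]; exists k => //; have [sk Xk] := ex.
  by split => //; split => //; rewrite -(deficit_exit ex).
move=> [k _ [sk [Xk Dk]]].
have ex : exit_at X k [set x | x < 0] w by [].
split; first by rewrite /= (deficit_exit ex).
by rewrite /ruin/= (ruin_time_exit ex) ltry.
Qed.

End ruin_paths.

(** * Laws determined by half-lines *)

Section laws.
Context {R : realType}.
Local Open Scope ereal_scope.

(** The half-lines `]-oo, t] form a pi-system that generates the Borel sets. *)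
Lemma eq_measure_cdf (m1 m2 : {measure set (measurableTypeR R) -> \bar R}) :
  (forall t, m1 `]-oo, t]%classic = m2 `]-oo, t]%classic) ->
  (forall t, m1 `]-oo, t]%classic < +oo) ->
  forall A, measurable A -> m1 A = m2 A.
Proof.
move=> m12 m1oo A mA.
pose G : set (set R) := [set B | exists t, B = `]-oo, t]%classic].
have mG : @measurable _ (measurableTypeR R) = <<s G >>.
  rewrite [LHS](RGenOInfty.measurableE R); apply/seteqP; split.
    apply: smallest_sub; first exact: smallest_sigma_algebra.
    move=> _ [t ->]; rewrite -setCitvl.
    apply: (@measurableC _ (g_sigma_algebraType G)).
    by apply: sub_sigma_algebra; exists t.
  rewrite -[X in _ `<=` X](RGenOInfty.measurableE R).
  apply: smallest_sub.
    exact: (@sigma_algebra_measurable _ (measurableTypeR R)).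
  by move=> _ [t ->]; exact: measurable_itv.
apply: (@measure_unique _ R (measurableTypeR R) G
  (fun n : nat => `]-oo, (n%:R : R)%R]%classic) mG) => //.
- move=> _ _ [t ->] [u ->]; exists (Num.min t u).
  by apply/seteqP; split => x /=; rewrite !in_itv/= le_min => /andP.
- by move=> n; exists n%:R%R.
- rewrite -subTset => x _; exists (Num.bound `|x|%R) => //=.
  by rewrite in_itv/= (le_trans (ler_norm x))// ltW// archi_boundP.
- by move=> _ [t ->].
Qed.

Lemma exponential_prob_half (m t : R) : (0 < m)%R ->
  exponential_prob m `]-oo, t] =
  if (0 <= t)%R then (1 - expR (- m * t))%:E else 0.
Proof.
move=> m0; rewrite -exponential_cdf// /exponential_prob integral_mkcond.
apply: eq_integral => s _; rewrite patchE mem_setE in_itv/=.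
by case: ifP.
Qed.

Section scaled.
Context d (Omega : measurableType d) (P : probability Omega R).
Variables (S : {RV P >-> R}) (l c : R).
Hypotheses (l0 : (0 < l)%R) (c0 : (0 < c)%R).
Hypothesis lawS : forall A : set R, measurable A ->
  P (S @^-1` A) = exponential_prob l A.

Let m0 : (0 < l / c)%R. Proof. exact: divr_gt0. Qed.

Lemma distribution_scaled (h : R -> \bar R) :
  measurable_fun setT h -> (forall x, 0 <= h x) ->
  \int[P]_w h (c * S w)%R =
  \int[@lebesgue_measure R]_s (h s * (exponential_pdf (l / c) s)%:E).
Proof.
move=> mh h0.
pose cS : Omega -> measurableTypeR R := fun w => (c * S w)%R.
have mcS : measurable_fun setT cS by exact: measurable_funM.
(* E is the exponential law as an abstract measure, which can only be computed
   through the equation EE. *)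
have [E EE] : exists E : {measure set (measurableTypeR R) -> \bar R},
    E = exponential_prob (l / c) :> (set R -> \bar R).
  by unshelve eexists (exponential_prob (l / c)%R).
transitivity (\int[pushforward P cS]_x h x).
  by rewrite ge0_integral_pushforward.
apply: (@ge0_integral_density R _ (measurableTypeR R) (@lebesgue_measure R)
  (pushforward P cS) (exponential_pdf (l / c)%R) h) => //.
- exact: measurable_exponential_pdf.
- by move=> x; rewrite exponential_pdf_ge0// ltW.
move=> A mA; rewrite -[RHS]/(exponential_prob (l / c)%R A) -EE.
apply: (@eq_measure_cdf (pushforward P cS) E) => // t.
- rewrite /pushforward/=.
  rewrite EE (exponential_prob_half t m0).
  transitivity (P (S @^-1` `]-oo, (t / c)%R])).
    congr (P _); apply/seteqP; split => w /=; rewrite !in_itv/= ler_pdivlMr//;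
    by rewrite mulrC.
  rewrite lawS// exponential_prob_half// pmulr_lge0 ?invr_gt0//.
  by rewrite !mulNr mulrA mulrAC.
- apply: (@le_lt_trans _ _ 1); last exact: ltry.
  apply: probability_le1; rewrite -[X in measurable X]setTI.
  by apply: mcS => //; exact: measurable_itv.
Qed.

End scaled.

End laws.

(** * Mixtures selected by a one-hot vector *)

Section one_hot_mixture.
Context {R : realType} {d : measure_display} {Omega : measurableType d}.
Variables (P : probability Omega R) (A B C U V W : Omega -> R) (a b c : R).
Hypotheses (mA : measurable_fun setT A) (mB : measurable_fun setT B)
  (mC : measurable_fun setT C) (mU : measurable_fun setT U)
  (mV : measurable_fun setT V) (mW : measurable_fun setT W).
Hypothesis abc1 : a + b + c = 1.
Hypothesis onehot : one_hot_law P A B C a b c.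
Let ABC w := (A w, B w, C w).
Hypotheses (iU : independent2 P (sigma_rv ABC) (sigma_rv U))
  (iV : independent2 P (sigma_rv ABC) (sigma_rv V))
  (iW : independent2 P (sigma_rv ABC) (sigma_rv W)).
Local Open Scope ereal_scope.

Let mABC : measurable_fun setT ABC.
Proof. by apply: measurable_fun_pair => //; exact: measurable_fun_pair. Qed.

Let measurable_point (e : R * R * R) : measurable [set e].
Proof.
case: e => [[x y] z].
rewrite (_ : [set (x, y, z)] = ([set x] `*` [set y]) `*` [set z]).
  by apply: measurableX => //; exact: measurableX.
by apply/seteqP; split => [_ -> //|[[x' y'] z'] /= [[-> ->] ->]].
Qed.

Let fiber e := ABC @^-1` [set e].

Let mfiber e : measurable (fiber e).
Proof. by rewrite /fiber -[X in measurable X]setTI; exact: mABC. Qed.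

Let mixture_term (h : R -> \bar R) e (Z : Omega -> R) :
  measurable_fun setT h -> (forall x, 0 <= h x) -> measurable_fun setT Z ->
  independent2 P (sigma_rv ABC) (sigma_rv Z) ->
  \int[P]_w ((\1_(fiber e) w)%:E * h (Z w)) = P (fiber e) * \int[P]_w h (Z w).
Proof.
move=> mh h0 mZ iZ.
have mhZ : measurable_fun setT (fun w => h (Z w)) by exact: measurableT_comp.
transitivity (\int[P]_w ((\1_[set e] (ABC w) : R)%:E * h (Z w))) => //.
rewrite (integral_independent mABC mZ iZ
    (f := fun v x => (\1_[set e] v : R)%:E * h x)); last 2 first.
- apply: emeasurable_funM; last exact: (measurableT_comp mh measurable_snd).
  apply/measurable_EFinP.
  exact: (measurableT_comp (measurable_indic (measurable_point e))
    measurable_fst).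
- by move=> v x; rewrite mule_ge0// lee_fin.
under eq_integral do rewrite ge0_integralZl//.
rewrite ge0_integralZr//; last 2 first.
- apply/measurable_EFinP.
  exact: (measurableT_comp (measurable_indic (measurable_point e)) mABC).
- by apply: integral_ge0.
congr (_ * _); transitivity (\int[P]_w (\1_(fiber e) w)%:E) => //.
by rewrite integral_indic// setIT.
Qed.

(** On the event that ABC is the k-th unit vector the sum is the k-th variable,
    which is independent of this event; as a + b + c = 1, the three events
    carry the whole mass. *)
Lemma one_hot_mixture (h : R -> \bar R) :
  measurable_fun setT h -> (forall x, 0 <= h x) ->
  \int[P]_w h (A w * U w + B w * V w + C w * W w)%R =
  a%:E * \int[P]_w h (U w) + b%:E * \int[P]_w h (V w)
  + c%:E * \int[P]_w h (W w).
Proof.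
move=> mh h0; have [Pa Pb Pc] := onehot.
have fE x y z : fiber (x, y, z) = [set w | [/\ A w = x, B w = y & C w = z]].
  apply/seteqP; split => w; first by case.
  by move=> [Ax By Cz]; rewrite /fiber /= /ABC Ax By Cz.
rewrite -Pa -Pb -Pc -!fE -!mixture_term//.
have m1 e Z : measurable_fun setT Z ->
    measurable_fun setT (fun w => (\1_(fiber e) w : R)%:E * h (Z w)).
  move=> mZ; apply: emeasurable_funM; last exact: measurableT_comp.
  exact/measurable_EFinP.
have p1 e (Z : Omega -> R) w : 0 <= (\1_(fiber e) w : R)%:E * h (Z w).
  by rewrite mule_ge0// lee_fin.
rewrite -ge0_integralD//; [|exact: m1|exact: m1].
rewrite -ge0_integralD//; last 3 first.
- by move=> w _; rewrite adde_ge0.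
- by apply: emeasurable_funD; exact: m1.
- exact: m1.
apply: ge0_ae_eq_integral => //.
- apply: (measurableT_comp mh); apply: measurable_funD;
    last exact: measurable_funM.
  by apply: measurable_funD; exact: measurable_funM.
- by apply: emeasurable_funD; [apply: emeasurable_funD|]; exact: m1.
- by move=> w _; rewrite !adde_ge0.
pose G := fiber (1, 0, 0)%R `|` fiber (0, 1, 0)%R `|` fiber (0, 0, 1)%R.
have mG : measurable G by do 2! apply: measurableU => //.
have disj e e' : e != e' -> fiber e `&` fiber e' = set0.
  move=> ee'; apply/seteqP; split => // w [/= we we'].
  by apply: (negP ee'); rewrite -we -we'.
have PG : P G = 1.
  transitivity (P (fiber (1, 0, 0)%R) + P (fiber (0, 1, 0)%R)
      + P (fiber (0, 0, 1)%R)).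
    2: by rewrite !fE Pa Pb Pc -!EFinD abc1.
  rewrite measureU//; last 2 first.
  - exact: measurableU.
  - by rewrite setIUl !disj ?setU0// !xpair_eqE ?oner_eq0 ?(eq_sym 0%R)
      ?oner_eq0 ?andbF.
  by rewrite measureU// disj// !xpair_eqE oner_eq0.
exists (~` G); split; first exact: measurableC.
  by transitivity (1 - P G); [exact: probability_setC|rewrite PG subee].
move=> w /= nw Gw; apply: nw => _.
rewrite !indicE.
have fiberE e : (w \in fiber e) = (ABC w == e).
  by apply/idP/eqP => [/set_mem|we]; [exact|exact/mem_set].
rewrite !fiberE /ABC; case: Gw => [[|]|] [-> -> ->].
- rewrite !xpair_eqE !eqxx !oner_eq0 /= !mul0e !adde0 !mul1e.
  by rewrite !mul0r !mul1r !addr0.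
- rewrite !xpair_eqE !eqxx !oner_eq0 !(eq_sym 0%R) !oner_eq0 /= !mul0e mul1e.
  by rewrite add0e adde0 !mul0r !mul1r !addr0 add0r.
- rewrite !xpair_eqE !eqxx !(eq_sym 0%R) !oner_eq0 /= !mul0e mul1e !add0e.
  by rewrite !mul0r !mul1r !add0r.
Qed.

Lemma one_hot_cdf t :
  P [set w | A w * U w + B w * V w + C w * W w <= t]%R =
  a%:E * P [set w | U w <= t]%R + b%:E * P [set w | V w <= t]%R
  + c%:E * P [set w | W w <= t]%R.
Proof.
pose h (x : R) : \bar R := if (x <= t)%R then 1 else 0.
have mh : measurable_fun setT h.
  by apply: measurable_fun_ifT => //; exact: measurable_fun_ler.
have h0 x : 0 <= h x by rewrite /h; case: ifP.
have PE (Z : Omega -> R) : measurable_fun setT Z ->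
    P [set w | Z w <= t]%R = \int[P]_w h (Z w).
  move=> mZ; have mt : measurable [set w | Z w <= t]%R.
    rewrite -[X in measurable X]setTI.
    exact: (measurable_fun_le measurableT mZ (measurable_cst t)).
  transitivity (\int[P]_w (\1_[set w | (Z w <= t)%R] w : R)%:E).
    by rewrite integral_indic// setIT.
  apply: eq_integral => w _; rewrite indicE /h.
  by case: ifPn => Zt; [rewrite mem_set|rewrite memNset//; exact/negP].
rewrite !PE// ?one_hot_mixture//.
by apply: measurable_funD; first apply: measurable_funD; exact: measurable_funM.
Qed.

End one_hot_mixture.

(** * Overshoot and tail integrals *)

Section overshoot_tail.
Context {R : realType} {d : measure_display} {Omega : measurableType d}.
Variables (P : probability Omega R) (Y : Omega -> R).
Hypothesis mY : measurable_fun setT Y.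
Hypothesis Y0 : {ae P, forall w, 0 <= Y w}.
Local Notation leb := (@lebesgue_measure R).
Local Open Scope ereal_scope.

Lemma integral_Interval (b1 b2 : itv_bound R) :
  \int[leb]_u (\1_([set` Interval b1 b2]) u : R)%:E =
  leb [set` Interval b1 b2].
Proof. by rewrite integral_indic// setIT. Qed.

Let mexcess : measurable_fun setT (fun p : Omega * R => (p.2 - Y p.1)%R).
Proof.
exact: (measurable_funB measurable_snd (measurableT_comp mY measurable_fst)).
Qed.

Lemma measurable_overshoot (B : set R) : measurable B ->
  measurable_fun setT
    (fun w => \int[leb]_u cut (fun u => (\1_B (u - Y w) : R)%:E) u).
Proof.
move=> mB.
apply: (measurable_fun_fubini_tonelli_F (m2 := leb) (fun p : Omega * R =>
  cut (fun u => (\1_B (u - Y p.1) : R)%:E) p.2)); last first.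
  by move=> p; apply: cut_ge0 => u; rewrite lee_fin.
apply: measurable_fun_ifT => //.
  exact: (measurable_fun_ler (measurable_cst _) measurable_snd).
apply/measurable_EFinP.
exact: (measurableT_comp (measurable_indic mB) mexcess).
Qed.

Lemma tail_probabilityE (x : R) :
  P [set w | (x <= Y w)%R] = \int[P]_w (if (x <= Y w)%R then 1 else 0).
Proof.
have mx : measurable [set w | (x <= Y w)%R].
  rewrite -[X in measurable X]setTI.
  exact: (measurable_fun_le measurableT (measurable_cst x) mY).
transitivity (\int[P]_w (\1_[set w | (x <= Y w)%R] w : R)%:E).
  by rewrite integral_indic// setIT.
apply: eq_integral => w _; rewrite indicE.
by case: ifPn => xY; [rewrite mem_set|rewrite memNset//; exact/negP].
Qed.

(** The reserves u >= 0 that a claim Y makes negative form [0, Y). *)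
Lemma overshoot_neg :
  overshoot P Y (EFin \o \1_(`]-oo, 0%R[%classic : set R)) = \int[P]_w (Y w)%:E.
Proof.
pose Y' w := Num.max 0%R (Y w).
have mY' : measurable_fun setT Y' by exact: measurable_maxr.
transitivity (\int[P]_w (Y' w)%:E); last first.
  apply: ae_eq_integral => //; try exact/measurable_EFinP.
  by apply: filterS Y0 => w Yw _; rewrite /Y' max_r.
apply: ge0_ae_eq_integral => //.
- exact: measurable_overshoot.
- exact/measurable_EFinP.
- move=> w _; apply: integral_ge0 => u _.
  by apply: cut_ge0 => v; rewrite lee_fin.
- by move=> w _; rewrite lee_fin le_max lexx.
apply: filterS Y0 => w Yw _; rewrite /Y' max_r//.
transitivity (leb `[0%R, Y w[%classic).
  rewrite -integral_Interval; apply: eq_integral => u _.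
  rewrite /cut /= !indicE !mem_setE !in_itv/= subr_lt0.
  by case: (0 <= u)%R.
rewrite lebesgue_measure_itv/= lte_fin -EFinB subr0.
by case: ltP => // Yle; congr EFin; apply/eqP; rewrite eq_le Yw Yle.
Qed.

(** The reserves u >= 0 that a claim Y takes into [-y, 0) form the interval
    [max (0, Y - y), Y). Its length min (y, Y) is also that of the set of the x
    in [0, y] with x <= Y, and Fubini turns the mean of the latter into the
    tail integral. *)
Lemma overshoot_tail (y : R) : (0 <= y)%R ->
  overshoot P Y (EFin \o \1_(`[(- y)%R, 0%R[%classic : set R)) =
  tail_integral P Y y.
Proof.
move=> y0; rewrite /tail_integral.
pose k w x := if (x <= Y w)%R then (\1_(`[0%R, y]%classic) x : R)%:E else 0.
have k0 w x : 0 <= k w x by rewrite /k; case: ifP; rewrite ?lee_fin.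
have mk : measurable_fun setT (fun p => k p.1 p.2).
  apply: measurable_fun_ifT => //.
    apply: measurable_fun_ler; first exact: measurable_snd.
    exact: (measurableT_comp mY measurable_fst).
  apply/measurable_EFinP.
  have mI : measurable (`[0%R, y]%classic : set R) by exact: measurable_itv.
  exact: (measurableT_comp (measurable_indic mI) measurable_snd).
transitivity (\int[leb]_x \int[P]_w k w x); last first.
  rewrite [RHS]integral_mkcond; apply: eq_integral => x _; rewrite patchE.
  case: ifPn => xy.
    rewrite tail_probabilityE; apply: eq_integral => w _.
    by rewrite /k indicE xy.
  rewrite integral0_eq// => w _; rewrite /k indicE (negPf xy).
  by case: ifP.
rewrite -(@tonelli _ _ _ _ _ P leb k mk k0).
apply: ge0_ae_eq_integral => //.
- exact: measurable_overshoot.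
- exact: (measurable_fun_fubini_tonelli_F (m2 := leb) (fun p => k p.1 p.2)).
- move=> w _; apply: integral_ge0 => u _.
  by apply: cut_ge0 => v; rewrite lee_fin.
- by move=> w _; exact: integral_ge0.
apply: filterS Y0 => w Yw _.
transitivity (leb `[Num.max 0%R (Y w - y)%R, Y w[%classic).
  rewrite -integral_Interval; apply: eq_integral => u _.
  rewrite /cut /= !indicE !mem_setE !in_itv/= subr_lt0 ge_max lerBrDr.
  by rewrite (addrC (- y)%R); case: (0 <= u)%R.
transitivity (leb `[0%R, Num.min y (Y w)]%classic); last first.
  rewrite -integral_Interval; apply: eq_integral => u _.
  rewrite /k !indicE !mem_setE !in_itv/= le_min.
  by case: (0 <= u)%R => //=; case: (u <= y)%R => //=; case: (u <= Y w)%R.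
rewrite !lebesgue_measure_itv/= !lte_fin -!EFinB subr0.
have [yY|Yy] := leP y (Y w).
  rewrite max_r ?subr_ge0// gtrBl subKr.
  by case: ltP => // y0'; congr EFin; apply/eqP; rewrite eq_le y0 y0'.
rewrite max_l ?subr_le0 ?ltW// subr0.
by case: ltP => // Y0'; congr EFin; apply/eqP; rewrite eq_le Yw Y0'.
Qed.

Lemma measurable_tail_probability :
  measurable_fun setT (fun x : R => P [set w | (x <= Y w)%R]).
Proof.
under eq_fun do rewrite tail_probabilityE.
apply: (measurable_fun_fubini_tonelli_F (m2 := P) (fun p : R * Omega =>
  if (p.1 <= Y p.2)%R then 1 else 0)); last by move=> p; case: ifP.
apply: measurable_fun_ifT => //.
exact: (measurable_fun_ler measurable_fst (measurableT_comp mY measurable_snd)).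
Qed.

Lemma tail_integral_ge0 y : 0 <= tail_integral P Y y.
Proof. exact: integral_ge0. Qed.

Lemma tail_integral_lty y : tail_integral P Y y < +oo.
Proof.
apply: (@le_lt_trans _ _ (\int[leb]_(x in `[0%R, y]) cst 1 x)).
  apply: ge0_le_integral => //.
  - exact: (measurable_funTS measurable_tail_probability).
  - move=> x _; apply: probability_le1.
    rewrite -[X in measurable X]setTI.
    exact: (measurable_fun_le measurableT (measurable_cst x) mY).
rewrite integral_cst//= mul1e [X in X < _](lebesgue_measure_itv `[0%R, y])/=.
by case: ifP => _; rewrite -?EFinB ltry.
Qed.

End overshoot_tail.

(** * The deficit at ruin has the integrated tail distribution *)

Section deficit_law.
Context {R : realType} {d : measure_display} {Omega : measurableType d}.
Variables (P : probability Omega R) (l c : R) (N : R -> Omega -> nat).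
Variables (S : nat -> {RV P >-> R}) (Y : nat -> Omega -> R).
Hypotheses (l0 : 0 < l) (c0 : 0 < c).
Hypothesis S0 : forall n w, 0 < S n w.
Hypothesis NS :
  forall t w n, 0 <= t -> (n <= N t w)%N = (\sum_(k < n) S k w <= t).
Hypothesis lawS : forall k (A : set R), measurable A ->
  P (S k @^-1` A) = exponential_prob l A.
Hypothesis mY : forall k, measurable_fun setT (Y k).
Hypothesis idY : forall k, same_law P (Y k) P (Y 0%N).
Hypothesis Y0 : {ae P, forall w, 0 <= Y 0%N w}.
Hypothesis net : (\int[P]_w (Y 0%N w)%:E < ((l / c)^-1)%:E)%E.
Let X k w := Y k w - c * S k w.
Hypothesis indepYS :
  forall k, independent2 P (sigma_rv (Y k)) (sigma_rv (S k)).
Hypothesis indepX :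
  forall k, independent2 P (sigma_rv (stopped X k)) (sigma_rv (X k)).
Local Notation leb := (@lebesgue_measure R).
Local Notation pdf := (exponential_pdf (l / c)).
Local Open Scope ereal_scope.

Let m0 : (0 < l / c)%R. Proof. exact: divr_gt0. Qed.

Let mX k : measurable_fun setT (X k).
Proof. by apply: measurable_funB => //; exact: measurable_funM. Qed.

Let pdf0 s : 0 <= (pdf s)%:E.
Proof. by rewrite lee_fin exponential_pdf_ge0// ltW. Qed.

Lemma increment_law k (h : R -> \bar R) :
  measurable_fun setT h -> (forall x, 0 <= h x) ->
  \int[P]_w h (X k w) =
  \int[P]_w \int[leb]_s (h (Y 0%N w - s)%R * (pdf s)%:E).
Proof.
move=> mh h0.
have mhB : measurable_fun setT (fun p : R * R => h (p.1 - p.2)%R).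
  exact: (measurableT_comp mh (measurable_funB measurable_fst measurable_snd)).
have mhy (y : R) : measurable_fun setT (fun s : R => h (y - s)%R).
  by apply: (measurableT_comp mh); exact: measurable_funB.
rewrite /X (integral_independent (mY k) (measurable_funPT (S k)) (@indepYS k)
    (f := fun y s : R => h (y - c * s)%R))//; last first.
  have mcs : measurable_fun setT (fun p : R * R => (p.1 - c * p.2)%R).
    exact: (measurable_funB measurable_fst
      (measurable_funM (measurable_cst c) measurable_snd)).
  exact: (measurableT_comp mh mcs).
have := same_law_integral mY idY k
  (h := fun y : R => \int[leb]_s (h (y - s)%R * (pdf s)%:E)).
move=> <-; last 2 first.
- apply: (measurable_fun_fubini_tonelli_F (m2 := leb) (fun p : R * R =>
    h (p.1 - p.2)%R * (pdf p.2)%:E)); last by move=> p; rewrite mule_ge0.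
  apply: emeasurable_funM => //; apply/measurable_EFinP.
  exact: (measurableT_comp (measurable_exponential_pdf _) measurable_snd).
- by move=> y; apply: integral_ge0 => s _; rewrite mule_ge0.
apply: eq_integral => w _.
exact: (distribution_scaled l0 c0 (@lawS k) (mhy (Y k w))).
Qed.

Let idX k : same_law P (X k) P (X 0%N).
Proof.
move=> A mA.
have PE j : P (X j @^-1` A) = \int[P]_w (\1_A (X j w) : R)%:E.
  transitivity (\int[P]_w (\1_(X j @^-1` A) w : R)%:E) => //.
  rewrite integral_indic// ?setIT//.
  by rewrite -[X in measurable X]setTI; exact: mX.
have m1 : measurable_fun setT (EFin \o (\1_A : R -> R)).
  exact/measurable_EFinP.
by rewrite !PE !(increment_law _ (h := EFin \o \1_A)) // => x; rewrite lee_fin.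
Qed.

(** Ruin is an exit of the stopped walk; the probabilities of the exits are
    passage terms, whose sum is given by ladder_sum. *)
Theorem deficit_law (D : set R) : measurable D ->
  let B := [set x : R | (x < 0)%R /\ D (- x)%R] in
  overshoot P (Y 0%N) (EFin \o \1_B) < +oo ->
  P (deficit c N Y @^-1` D `&` ruin c N Y) =
  (l / c)%:E * overshoot P (Y 0%N) (EFin \o \1_B).
Proof.
move=> mD B Boo.
have mB : measurable B.
  rewrite (_ : B = `]-oo, 0%R[%classic `&` (-%R @^-1` D)); last first.
    by apply/seteqP; split => x /=; rewrite in_itv.
  apply: measurableI => //; rewrite -[X in measurable X]setTI.
  exact: (@oppr_measurable R setT).
rewrite (ruin_deficitE (S := fun k w => S k w))//.
rewrite (probability_exit mX indepX idX mB); last by move=> x [].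
apply: ladder_sum => //.
- by move=> h mh h0; exact: (increment_law 0%N mh h0).
- exact/measurable_EFinP.
- by move=> x; rewrite lee_fin.
Qed.

Section integrated_tail_deficit.
Variable e : R.
Hypothesis EYe : \int[P]_w (Y 0%N w)%:E = e%:E.
Hypothesis e0 : (0 < e)%R.

Lemma ruin_probability : P (ruin c N Y) = (l / c * e)%:E.
Proof.
have BE : [set x : R | (x < 0)%R /\ setT (- x)%R] = `]-oo, 0%R[%classic.
  by apply/seteqP; split => x /=; rewrite in_itv//= => -[].
have := @deficit_law setT measurableT; rewrite /= BE overshoot_neg//.
by rewrite EYe ltry preimage_setT setTI EFinM; exact.
Qed.

(** The ratio of deficit_law for D = `]-oo, t] to deficit_law for D = setT: the
    factor l / c cancels. *)
Theorem deficit_integrated_tail (t : R) :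
  cond_prob P (deficit c N Y @^-1` `]-oo, t]) (ruin c N Y) =
  if (0 <= t)%R then itail_cdf P (Y 0%N) t else 0.
Proof.
have BE : [set x : R | (x < 0)%R /\ `]-oo, t]%classic (- x)%R] =
    `[(- t)%R, 0%R[%classic.
  apply/seteqP; split => x /=; rewrite !in_itv/= lerNl.
    by move=> [-> ->].
  by move=> /andP[-> ->].
rewrite /cond_prob ruin_probability.
have := @deficit_law `]-oo, t]%classic (measurable_itv _).
rewrite /= BE; case: ifPn => [t0|]; last first.
  rewrite -ltNge => t0.
  have -> : overshoot P (Y 0%N) (EFin \o \1_(`[(- t)%R, 0%R[%classic)) = 0.
    rewrite /overshoot integral0_eq// => w _; rewrite integral0_eq// => u _.
    rewrite /cut; case: ifP => //= _.
    by rewrite set_itv_ge ?indic0// bnd_simp -leNgt oppr_ge0 ltW.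
  by move=> ->; rewrite ?ltry// mule0 mul0e.
rewrite overshoot_tail// => ->; last exact: tail_integral_lty.
rewrite /itail_cdf unlock EYe !inver !gt_eqF ?mulr_gt0 ?invr_gt0//.
rewrite muleAC -EFinM.
by rewrite invfM mulrA divff ?gt_eqF// mul1r.
Qed.

End integrated_tail_deficit.

End deficit_law.

(** * The array of independent sources of the risk model *)

Section generated_sigma_algebra.
Context {d d' : measure_display} {T : measurableType d} {U : measurableType d'}.
Implicit Types (G : set (set T)) (Z : T -> U).

Lemma measurable_fun_generated G Z : sigma_rv Z `<=` <<s G >> ->
  measurable_fun (setT : set (g_sigma_algebraType G)) Z.
Proof. by move=> ZG _ B mB; apply: ZG; exists B. Qed.

Lemma sigma_rv_generated G Z :
  measurable_fun (setT : set (g_sigma_algebraType G)) Z ->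
  sigma_rv Z `<=` <<s G >>.
Proof. by move=> mZ _ [B mB <-]; exact: mZ. Qed.

Lemma sigma_rvT Z : sigma_rv Z setT.
Proof. by exists setT; rewrite ?preimage_setT ?setTI. Qed.

Lemma sigma_rvI Z : setI_closed (sigma_rv Z).
Proof.
move=> _ _ [B mB <-] [C mC <-]; exists (B `&` C); first exact: measurableI.
by rewrite !setTI preimage_setI.
Qed.

Lemma sigma_rv_measurable Z :
  measurable_fun setT Z -> sigma_rv Z `<=` measurable.
Proof. by move=> mZ _ [B mB <-]; exact: mZ. Qed.

End generated_sigma_algebra.

Section poisson_gaps.
Context {R : realType} {d : measure_display} {Omega : measurableType d}.
Variables (S : nat -> Omega -> R) (N : R -> Omega -> nat).
Hypothesis S0 : forall n w, 0 < S n w.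
Hypothesis NS :
  forall t w n, 0 <= t -> (n <= N t w)%N = (\sum_(k < n) S k w <= t).

(** The event that the n-th epoch is after t >= 0 is N t < n: the epochs, hence
    the gaps, are functions of N. *)
Lemma sigma_gap n : sigma_rv (S n) `<=` sigma_family [set t : R | 0 <= t] N.
Proof.
pose G := \bigcup_(t in [set t : R | 0 <= t]) sigma_rv (N t).
pose A k w := \sum_(i < k) S i w.
have mA k : measurable_fun (setT : set (g_sigma_algebraType G)) (A k).
  apply: (measurability _ (RGenOInfty.measurableE R)) => //.
  move=> _ [_ [t ->] <-]; have [t0|t0] := leP 0 t.
    apply: sub_sigma_algebra; exists t => //; exists [set j | (j < k)%N] => //.
    congr (_ `&` _); apply/seteqP; split => w /=;
      by rewrite in_itv/= andbT ltnNge NS// -ltNge.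
  rewrite (_ : _ `&` _ = setT) //; apply/seteqP; split => // w _; split => //=.
  rewrite in_itv/= andbT (lt_le_trans t0)// sumr_ge0// => i _; exact: ltW.
apply: (@sigma_rv_generated _ _ _ _ G).
rewrite (_ : S n = A n.+1 \- A n); first exact: measurable_funB.
by apply/funext => w /=; rewrite /A big_ord_recr/= addrAC subrr add0r.
Qed.

End poisson_gaps.

Section risk_model.
Context {R : realType} {d : measure_display} {Omega : measurableType d}.
Variable P : probability Omega R.
Variables (N : R -> Omega -> nat).
Variables (S Y1 Y2 Y3 Y4 I1 I2 I0 : nat -> {RV P >-> R}).
Let Y34 := fun i w => (Y3 i w, Y4 i w).
Let I120 := fun i w => (I1 i w, I2 i w, I0 i w).
Let Y := fun i w =>
  I1 i w * Y1 i w + I0 i w * (Y3 i w + Y4 i w) + I2 i w * Y2 i w.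
Hypotheses (iidS : iid P (S : nat -> Omega -> R))
  (iidY1 : iid P (Y1 : nat -> Omega -> R))
  (iidY2 : iid P (Y2 : nat -> Omega -> R))
  (iidY34 : iid P Y34) (iidI : iid P I120).
Hypothesis S0 : forall n w, 0 < S n w.
Hypothesis NS :
  forall t w n, 0 <= t -> (n <= N t w)%N = (\sum_(k < n) S k w <= t).
Hypothesis indep : mutually_independent P (fun k : 'I_5 =>
    nth set0 [:: sigma_family [set t : R | 0 <= t] N;
                 sigma_family setT (Y1 : nat -> Omega -> R);
                 sigma_family setT (Y2 : nat -> Omega -> R);
                 sigma_family setT Y34;
                 sigma_family setT I120] k).

(** The gaps stand for N: they are functions of N and, unlike the values of N,
    independent of each other, so that the model becomes an array of
    independent cells. *)
Definition source (j : 'I_5) (i : nat) : set (set Omega) :=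
  nth set0 [:: sigma_rv (S i); sigma_rv (Y1 i); sigma_rv (Y2 i);
               sigma_rv (Y34 i); sigma_rv (I120 i)] j.

Let sources (K : set ('I_5 * nat)) : set (set Omega) :=
  \bigcup_(p in K) source p.1 p.2.

Let mY34 i : measurable_fun setT (Y34 i).
Proof. exact: measurable_fun_pair. Qed.

Let mI120 i : measurable_fun setT (I120 i).
Proof. by apply: measurable_fun_pair => //; exact: measurable_fun_pair. Qed.

Let source_ind (Q : set (set Omega) -> Prop) i :
  Q (sigma_rv (S i)) -> Q (sigma_rv (Y1 i)) -> Q (sigma_rv (Y2 i)) ->
  Q (sigma_rv (Y34 i)) -> Q (sigma_rv (I120 i)) -> forall j, Q (source j i).
Proof.
by move=> q0 q1 q2 q3 q4 [[|[|[|[|[|//]]]]] jlt].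
Qed.

Lemma mutually_independent_sources :
  mutually_independent P (fun p : 'I_5 * nat => source p.1 p.2).
Proof.
apply: mutually_independent_pairs.
  by case=> [[|[|[|[|[|//]]]]] jlt]; [exact: iidS.1|exact: iidY1.1|
    exact: iidY2.1|exact: iidY34.1|exact: iidI.1].
move=> J E uJ JE; apply: indep => // i /JE.
case: i => [[|[|[|[|[|//]]]]] jlt] //=.
apply: smallest_sub; first exact: smallest_sigma_algebra.
by move=> A [n _]; exact: (sigma_gap S0 NS).
Qed.

Lemma independent2_sources K K' : K `&` K' `<=` set0 ->
  independent2 P <<s sources K >> <<s sources K' >>.
Proof.
apply: independent2_grouping.
- move=> [j i]; apply: (@source_ind (fun G => G `<=` measurable));
    exact: sigma_rv_measurable.
- move=> [j i]; apply: (@source_ind (fun G => G setT)); exact: sigma_rvT.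
- move=> [j i]; apply: (@source_ind (fun G => setI_closed G)); exact: sigma_rvI.
- exact: mutually_independent_sources.
Qed.

Let sub_sources K j i : K (j, i) -> source j i `<=` <<s sources K >>.
Proof. by move=> Kji A jA; apply: sub_sigma_algebra; exists (j, i). Qed.

(** Measurability with respect to the cells in K; the independence of two
    variables follows if they are measurable for disjoint sets of cells. *)
Section sub.
Variable K : set ('I_5 * nat).
Local Notation measurable_src Z :=
  (measurable_fun (setT : set (g_sigma_algebraType (sources K))) Z).

Lemma src_S i : K (inord 0, i) -> measurable_src (S i).
Proof.
move=> Ki; apply: measurable_fun_generated => A ZA.
by apply: (sub_sources Ki); rewrite /source inordK.
Qed.

Lemma src_Y1 i : K (inord 1, i) -> measurable_src (Y1 i).
Proof.
move=> Ki; apply: measurable_fun_generated => A ZA.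
by apply: (sub_sources Ki); rewrite /source inordK.
Qed.

Lemma src_Y2 i : K (inord 2, i) -> measurable_src (Y2 i).
Proof.
move=> Ki; apply: measurable_fun_generated => A ZA.
by apply: (sub_sources Ki); rewrite /source inordK.
Qed.

Lemma src_Y34 i : K (inord 3, i) -> measurable_src (Y34 i).
Proof.
move=> Ki; apply: measurable_fun_generated => A ZA.
by apply: (sub_sources Ki); rewrite /source inordK.
Qed.

Lemma src_I120 i : K (inord 4, i) -> measurable_src (I120 i).
Proof.
move=> Ki; apply: measurable_fun_generated => A ZA.
by apply: (sub_sources Ki); rewrite /source inordK.
Qed.

Lemma src_Y3D4 i : K (inord 3, i) -> measurable_src (fun w => Y3 i w + Y4 i w).
Proof.
move=> /src_Y34 m34.
exact: (measurable_funD (measurableT_comp measurable_fst m34)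
  (measurableT_comp measurable_snd m34)).
Qed.

Lemma src_Y i : (forall j, j != ord0 -> K (j, i)) -> measurable_src (Y i).
Proof.
move=> Ki.
have nz n : (0 < n < 5)%N -> (inord n : 'I_5) != ord0.
  by move=> /andP[n0 n5]; rewrite -val_eqE/= inordK// -lt0n.
have mI := src_I120 (Ki _ (nz 4%N isT)).
have m1 := src_Y1 (Ki _ (nz 1%N isT)).
have m2 := src_Y2 (Ki _ (nz 2%N isT)).
have m34 := src_Y3D4 (Ki _ (nz 3%N isT)).
have mI1 : measurable_src (I1 i).
  exact: (measurableT_comp measurable_fst (measurableT_comp measurable_fst mI)).
have mI2 : measurable_src (I2 i).
  exact: (measurableT_comp measurable_snd (measurableT_comp measurable_fst mI)).
have mI0 : measurable_src (I0 i).
  exact: (measurableT_comp measurable_snd mI).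
by apply: measurable_funD; first apply: measurable_funD; exact: measurable_funM.
Qed.

End sub.

Let indep_sub d1 d2 (U1 : measurableType d1) (U2 : measurableType d2)
    (Z1 : Omega -> U1) (Z2 : Omega -> U2) K K' : K `&` K' `<=` set0 ->
  measurable_fun (setT : set (g_sigma_algebraType (sources K))) Z1 ->
  measurable_fun (setT : set (g_sigma_algebraType (sources K'))) Z2 ->
  independent2 P (sigma_rv Z1) (sigma_rv Z2).
Proof.
move=> KK' mZ1 mZ2; apply: independent2_sub (independent2_sources KK').
  exact: sigma_rv_generated.
exact: sigma_rv_generated.
Qed.

Lemma independent2_claim_gap k :
  independent2 P (sigma_rv (Y k)) (sigma_rv (S k)).
Proof.
apply: (@indep_sub _ _ _ _ _ _ [set p | p.1 != ord0 /\ p.2 = k]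
  [set (inord 0, k)]).
- move=> p [[/= + _] pE]; rewrite pE/= => /eqP[].
  by apply: val_inj; rewrite /= inordK.
- by apply: src_Y.
- exact: src_S.
Qed.

Lemma independent2_types k (Z : Omega -> R) (n : nat) : (n < 4)%N ->
  measurable_fun
    (setT : set (g_sigma_algebraType (sources [set (inord n, k)]))) Z ->
  independent2 P (sigma_rv (I120 k)) (sigma_rv Z).
Proof.
move=> n4; apply: (@indep_sub _ _ _ _ _ _ [set (inord 4, k)]).
  move=> p [-> [/(congr1 val)]]; rewrite /= !inordK// => [n4E|].
    by rewrite -n4E in n4.
  exact: leq_trans n4 _.
exact: src_I120.
Qed.

Let X c k w := Y k w - c * S k w.

Let src_X c K k : (forall j, K (j, k)) ->
  measurable_fun (setT : set (g_sigma_algebraType (sources K))) (X c k).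
Proof.
move=> Kk; apply: measurable_funB; first exact: src_Y.
by apply: measurable_funM => //; exact: src_S.
Qed.

(** The stopped walk before step k only depends on the cells of index less than
    k. *)
Lemma independent2_stopped c k :
  independent2 P (sigma_rv (stopped (X c) k)) (sigma_rv (X c k)).
Proof.
apply: (@indep_sub _ _ _ _ _ _ [set p | (p.2 < k)%N] [set p | p.2 = k]).
- by move=> p [/= + pk]; rewrite pk ltnn.
- suff H n : (n <= k)%N -> measurable_fun
    (setT : set (g_sigma_algebraType (sources [set p | (p.2 < k)%N])))
    (stopped (X c) n) by exact: H.
  elim: n => [|n ih] nk; first exact: measurable_cst.
  have mn := ih (ltnW nk).
  apply: measurable_fun_ifT => //; first exact: measurable_fun_ler.
  by apply: measurable_funB => //; exact: src_X.
- exact: src_X.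
Qed.

Variables (l0 l1 l2 : R).
Hypotheses (l0_gt0 : 0 < l0) (l1_gt0 : 0 < l1) (l2_gt0 : 0 < l2).
Let lam := l0 + l1 + l2.
Hypothesis onehot : forall i, one_hot_law P (I1 i) (I2 i) (I0 i)
  (l1 / lam) (l2 / lam) (l0 / lam).
Let Y0 i w := Y3 i w + Y4 i w.
Local Open Scope ereal_scope.

Let lam_gt0 : (0 < lam)%R. Proof. by rewrite !addr_gt0. Qed.

Let weight_ge0 l : (0 < l)%R -> 0 <= (l / lam)%:E.
Proof. by move=> l_gt0; rewrite lee_fin divr_ge0// ltW. Qed.

Let mY0 i : measurable_fun setT (Y0 i).
Proof. exact: measurable_funD. Qed.

Lemma measurable_claim k : measurable_fun setT (Y k).
Proof.
have m0 := mY0 k.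
by apply: measurable_funD; first apply: measurable_funD; exact: measurable_funM.
Qed.

Lemma claim_mixture k (h : R -> \bar R) :
  measurable_fun setT h -> (forall x, 0 <= h x) ->
  \int[P]_w h (Y k w) = (l1 / lam)%:E * \int[P]_w h (Y1 0%N w)
    + (l2 / lam)%:E * \int[P]_w h (Y2 0%N w)
    + (l0 / lam)%:E * \int[P]_w h (Y0 0%N w).
Proof.
move=> mh h0.
have idY0 i : same_law P (Y0 i) P (Y0 0%N).
  move=> A mA.
  have mB : measurable ((fun p : R * R => p.1 + p.2)%R @^-1` A).
    rewrite -[X in measurable X]setTI.
    by apply: (measurable_funD measurable_fst measurable_snd).
  exact: (iidY34.2 i _ mB).
rewrite -(same_law_integral (fun i => measurable_funPT (Y1 i)) iidY1.2 k)//.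
rewrite -(same_law_integral (fun i => measurable_funPT (Y2 i)) iidY2.2 k)//.
rewrite -(same_law_integral mY0 idY0 k)//.
rewrite -(one_hot_mixture (A := I1 k) (B := I2 k) (C := I0 k))//.
- by apply: eq_integral => w _; rewrite /Y addrAC.
- by rewrite -!mulrDl [X in (X / _)%R](_ : _ = lam) ?divff ?gt_eqF// /lam; ring.
- by apply: (@independent2_types _ _ 1) => //; exact: src_Y1.
- by apply: (@independent2_types _ _ 2) => //; exact: src_Y2.
- by apply: (@independent2_types _ _ 3) => //; exact: src_Y3D4.
Qed.

Lemma same_law_claim k : same_law P (Y k) P (Y 0%N).
Proof.
move=> A mA.
have PE j : P (Y j @^-1` A) = \int[P]_w (EFin \o \1_A) (Y j w).
  transitivity (\int[P]_w (\1_(Y j @^-1` A) w : R)%:E) => //.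
  rewrite integral_indic// ?setIT//.
  by rewrite -[X in measurable X]setTI; exact: measurable_claim.
have m1 : measurable_fun setT (EFin \o (\1_A : R -> R)).
  exact/measurable_EFinP.
by rewrite !PE !(claim_mixture _ m1)// => x; rewrite lee_fin.
Qed.

Hypotheses (Y1_gt0 : {ae P, forall w, (0 < Y1 0%N w)%R})
  (Y2_gt0 : {ae P, forall w, (0 < Y2 0%N w)%R})
  (Y3_gt0 : {ae P, forall w, (0 < Y3 0%N w)%R})
  (Y4_gt0 : {ae P, forall w, (0 < Y4 0%N w)%R}).

Lemma total_gt0 : {ae P, forall w, (0 < Y0 0%N w)%R}.
Proof. by apply: filterS2 Y3_gt0 Y4_gt0 => w; exact: addr_gt0. Qed.

(** By the mixture formula for the indicator of the negative numbers. *)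
Lemma claim_ge0 : {ae P, forall w, (0 <= Y 0%N w)%R}.
Proof.
pose h (x : R) : \bar R := if (x < 0)%R then 1 else 0.
have mh : measurable_fun setT h.
  by apply: measurable_fun_ifT => //; exact: measurable_fun_ltr.
have h0 x : 0 <= h x by rewrite /h; case: ifP.
have hZ (Z : Omega -> R) : measurable_fun setT Z ->
    {ae P, forall w, (0 < Z w)%R} -> \int[P]_w h (Z w) = 0.
  move=> mZ Z0; rewrite -(integral0 P setT).
  apply: ae_eq_integral => //; first exact: measurableT_comp.
  by apply: filterS Z0 => w Zw _; rewrite /h ltNge ltW.
have : \int[P]_w `|h (Y 0%N w)| = 0.
  under eq_integral do rewrite gee0_abs//.
  by rewrite claim_mixture// !hZ//; [rewrite !mule0 !adde0|exact: total_gt0].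
have mhY : measurable_fun setT (h \o Y 0%N).
  by apply: measurableT_comp => //; exact: measurable_claim.
move/(ae_eq_integral_abs P measurableT mhY); apply: filterS => w /(_ I) /=.
rewrite leNgt /h; case: ifP => // _ /eqP; by rewrite onee_eq0.
Qed.

(** P (x <= Y) is a mixture for each x, and the integral over x is linear. *)
Lemma claim_tail_integral y :
  tail_integral P (Y 0%N) y = (l1 / lam)%:E * tail_integral P (Y1 0%N) y
    + (l2 / lam)%:E * tail_integral P (Y2 0%N) y
    + (l0 / lam)%:E * tail_integral P (Y0 0%N) y.
Proof.
pose tail (Z : Omega -> R) x := P [set w | (x <= Z w)%R].
have tail0 Z x : 0 <= tail Z x by exact: measure_ge0.
have mtail Z : measurable_fun setT Z ->
    measurable_fun (`[0%R, y]%classic : set R) (tail Z).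
  by move=> mZ; apply: measurable_funTS; exact: measurable_tail_probability.
have mt1 := mtail _ (measurable_funPT (Y1 0%N)).
have mt2 := mtail _ (measurable_funPT (Y2 0%N)).
have mt0 := mtail _ (mY0 0%N).
rewrite /tail_integral -!ge0_integralZl//; try exact: weight_ge0.
rewrite -ge0_integralD//; last 4 first.
- by move=> x _; rewrite mule_ge0// weight_ge0.
- exact: measurable_funeM.
- by move=> x _; rewrite mule_ge0// weight_ge0.
- exact: measurable_funeM.
rewrite -ge0_integralD//; last 4 first.
- by move=> x _; rewrite adde_ge0// mule_ge0// weight_ge0.
- by apply: emeasurable_funD; exact: measurable_funeM.
- by move=> x _; rewrite mule_ge0// weight_ge0.
- exact: measurable_funeM.
apply: eq_integral => x _.
rewrite !tail_probabilityE//; try exact: measurable_claim.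
rewrite (claim_mixture 0%N (h := fun z => if (x <= z)%R then 1 else 0))//.
  by apply: measurable_fun_ifT => //; exact: measurable_fun_ler.
by move=> z; case: ifP.
Qed.

End risk_model.

(** * Expectations of positive variables, and laws with the same c.d.f. *)

Section positive_expectation.
Context {R : realType} {d : measure_display} {Omega : measurableType d}.
Variable P : probability Omega R.
Local Open Scope ereal_scope.
Implicit Types Z : Omega -> R.

Lemma measurable_pos_part : measurable_fun setT (fun x : R => (Num.max 0 x)%:E).
Proof. by apply/measurable_EFinP; exact: measurable_maxr. Qed.

Lemma pos_part_ge0 (x : R) : 0 <= (Num.max 0%R x)%:E.
Proof. by rewrite lee_fin le_max lexx. Qed.

(** Positive parts turn almost sure positivity into positivity everywhere. *)
Lemma expectation_pos_part Z : measurable_fun setT Z ->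
  {ae P, forall w, (0 <= Z w)%R} ->
  'E_P[Z] = \int[P]_w (Num.max 0%R (Z w))%:E.
Proof.
move=> mZ Z0; rewrite unlock; apply: ae_eq_integral => //.
- exact/measurable_EFinP.
- by apply/measurable_EFinP; exact: measurable_maxr.
- by apply: filterS Z0 => w Zw _; rewrite max_r.
Qed.

Lemma expectation_gt0 Z : measurable_fun setT Z ->
  {ae P, forall w, (0 < Z w)%R} -> 0 < 'E_P[Z].
Proof.
move=> mZ Z0.
have Z0' : {ae P, forall w, (0 <= Z w)%R} by apply: filterS Z0 => w; exact: ltW.
rewrite expectation_pos_part// lt_def integral_ge0 ?andbT; last first.
  by move=> w _; exact: pos_part_ge0.
apply/eqP => E0.
have : \int[P]_w `|(Num.max 0%R (Z w))%:E| = 0.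
  by under eq_integral do rewrite gee0_abs ?pos_part_ge0//.
have mp := measurableT_comp measurable_pos_part mZ.
move/(ae_eq_integral_abs P measurableT mp) => Zle.
have : {ae P, forall w : Omega, False}.
  apply: filterS2 Z0 Zle => w Zw /(_ Logic.I) /= [].
  by rewrite max_r ?ltW// => /eqP; rewrite gt_eqF.
move=> [A [mA PA0 sA]].
have AT : A = setT by apply/seteqP; split => // w _; apply: sA.
by have := probability_setT P; rewrite -AT PA0 => /eqP; rewrite eq_sym onee_eq0.
Qed.

Lemma expectation_pos_fin Z : measurable_fun setT Z ->
  {ae P, forall w, (0 < Z w)%R} -> 'E_P[Z] < +oo ->
  (0 < fine 'E_P[Z])%R /\ 'E_P[Z] = (fine 'E_P[Z])%:E.
Proof.
move=> mZ Z0 Zoo; have EZ := expectation_gt0 mZ Z0.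
by split; [rewrite fine_gt0// EZ|rewrite fineK// ge0_fin_numE// ltW].
Qed.

Lemma expectationD_pos Z Z' : measurable_fun setT Z -> measurable_fun setT Z' ->
  {ae P, forall w, (0 <= Z w)%R} -> {ae P, forall w, (0 <= Z' w)%R} ->
  'E_P[fun w => (Z w + Z' w)%R] = 'E_P[Z] + 'E_P[Z'].
Proof.
move=> mZ mZ' Z0 Z0'.
have mp := measurableT_comp measurable_pos_part mZ.
have mp' := measurableT_comp measurable_pos_part mZ'.
rewrite !expectation_pos_part//; last 2 first.
- exact: measurable_funD.
- by apply: filterS2 Z0 Z0' => w; exact: addr_ge0.
rewrite -ge0_integralD//; last 2 first.
- by move=> w _; exact: pos_part_ge0.
- by move=> w _; exact: pos_part_ge0.
apply: ae_eq_integral => //.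
- exact: (measurableT_comp measurable_pos_part (measurable_funD mZ mZ')).
- exact: emeasurable_funD.
- by apply: filterS2 Z0 Z0' => w Zw Zw' _; rewrite !max_r ?addr_ge0.
Qed.

End positive_expectation.

Section law_of_cdf.
Context {R : realType}.
Local Open Scope ereal_scope.

Lemma same_law_cdf d d' (T : measurableType d) (T' : measurableType d')
    (P : probability T R) (P' : probability T' R) (Z : T -> R) (Z' : T' -> R) :
  measurable_fun setT Z -> measurable_fun setT Z' ->
  (forall t, P (Z @^-1` `]-oo, t]) = P' (Z' @^-1` `]-oo, t])) ->
  same_law P Z P' Z'.
Proof.
move=> mZ mZ' cdfE A mA.
pose W : T -> measurableTypeR R := Z.
pose W' : T' -> measurableTypeR R := Z'.
apply: (@eq_measure_cdf _ (pushforward P W) (pushforward P' W') cdfE) => // t.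
apply: (@le_lt_trans _ _ 1); last exact: ltry.
apply: probability_le1; rewrite -[X in measurable X]setTI.
by apply: mZ => //; exact: measurable_itv.
Qed.

End law_of_cdf.

(** * The mixture representation of the deficit *)

Theorem theorem4 (R : realType)
  (d : measure_display) (Omega : measurableType d) (P : probability Omega R)
  (l0 l1 l2 c : R)
  (Y1 Y2 Y3 Y4 I1 I2 I0 : nat -> {RV P >-> R})
  (N : R -> Omega -> nat) :
  let lam := l0 + l1 + l2 in
  let Y34 := fun i w => (Y3 i w, Y4 i w) in
  let I120 := fun i w => (I1 i w, I2 i w, I0 i w) in
  let Y := fun i w =>
    I1 i w * Y1 i w + I0 i w * (Y3 i w + Y4 i w) + I2 i w * Y2 i w in
  let EY1 := fine 'E_P[Y1 0%N] in
  let EY2 := fine 'E_P[Y2 0%N] in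
  let EY3 := fine 'E_P[Y3 0%N] in
  let EY4 := fine 'E_P[Y4 0%N] in
  let D := l1 * EY1 + l2 * EY2 + l0 * (EY3 + EY4) in
  let p1 := l1 * EY1 / D in
  let p2 := l2 * EY2 / D in
  let p0 := l0 * (EY3 + EY4) / D in
  0 < l0 -> 0 < l1 -> 0 < l2 ->
  iid P (Y1 : nat -> Omega -> R) -> iid P (Y2 : nat -> Omega -> R) ->
  iid P (Y3 : nat -> Omega -> R) -> iid P (Y4 : nat -> Omega -> R) ->
  iid P Y34 -> iid P I120 ->
  (forall i, {ae P, forall w, 0 < Y1 i w}) ->
  (forall i, {ae P, forall w, 0 < Y2 i w}) ->
  (forall i, {ae P, forall w, 0 < Y3 i w}) ->
  (forall i, {ae P, forall w, 0 < Y4 i w}) ->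
  ('E_P[Y1 0%N] < +oo)%E -> ('E_P[Y2 0%N] < +oo)%E ->
  ('E_P[Y3 0%N] < +oo)%E -> ('E_P[Y4 0%N] < +oo)%E ->
  (forall i, one_hot_law P (I1 i) (I2 i) (I0 i)
    (l1 / lam) (l2 / lam) (l0 / lam)) ->
  poisson_process P lam N ->
  mutually_independent P (fun k : 'I_5 =>
    nth set0 [:: sigma_family [set t : R | 0 <= t] N;
                 sigma_family setT (Y1 : nat -> Omega -> R);
                 sigma_family setT (Y2 : nat -> Omega -> R);
                 sigma_family setT Y34;
                 sigma_family setT I120] k) ->
  0 < c -> D < c ->
  (forall y : R, 0 <= y ->
    itail_cdf P (Y 0%N) y =
    ((p1 / EY1)%:E * tail_integral P (Y1 0%N) y
     + (p0 / (EY3 + EY4))%:E *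
         tail_integral P (fun w => (Y3 0%N w + Y4 0%N w)%R) y
     + (p2 / EY2)%:E * tail_integral P (Y2 0%N) y)%E)
  /\
  (forall (d' : measure_display) (Omega' : measurableType d')
     (P' : probability Omega' R)
     (J1 J2 J0 theta1 theta2 theta0 : {RV P' >-> R})
     (d'' : measure_display) (Omega'' : measurableType d'')
     (P'' : probability Omega'' R) (eta : {RV P'' >-> R}),
   one_hot_law P' J1 J2 J0 p1 p2 p0 ->
   has_itail_law P' theta1 P (Y1 0%N) ->
   has_itail_law P' theta2 P (Y2 0%N) ->
   has_itail_law P' theta0 P (fun w => Y3 0%N w + Y4 0%N w) ->
   independent2 P' (sigma_rv (fun w => (theta1 w, theta2 w, theta0 w)))
                   (sigma_rv (fun w => (J1 w, J2 w, J0 w))) ->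
   (forall A : set R, measurable A ->
      P'' (eta @^-1` A) =
      cond_prob P (deficit c N Y @^-1` A) (ruin c N Y)) ->
   same_law P'' eta
     P' (fun w => J1 w * theta1 w + J2 w * theta2 w + J0 w * theta0 w)).
Proof.
move=> lam Y34 I120 Y EY1 EY2 EY3 EY4 D p1 p2 p0 l0_gt0 l1_gt0 l2_gt0.
move=> iidY1 iidY2 _ _ iidY34 iidI Y1_gt0 Y2_gt0 Y3_gt0 Y4_gt0.
move=> Y1oo Y2oo Y3oo Y4oo onehot [S [iidS lawS0 S_gt0 NS]] indep c_gt0 Dc.
(* Y0 is the total of the two coordinates of a common claim. *)
pose Y0 w := Y3 0%N w + Y4 0%N w.
have mY0 : measurable_fun setT Y0 by exact: measurable_funD.
have [EY1_gt0 EY1E] :=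
  expectation_pos_fin (measurable_funPT (Y1 0%N)) (Y1_gt0 0%N) Y1oo.
have [EY2_gt0 EY2E] :=
  expectation_pos_fin (measurable_funPT (Y2 0%N)) (Y2_gt0 0%N) Y2oo.
have [EY3_gt0 EY3E] :=
  expectation_pos_fin (measurable_funPT (Y3 0%N)) (Y3_gt0 0%N) Y3oo.
have [EY4_gt0 EY4E] :=
  expectation_pos_fin (measurable_funPT (Y4 0%N)) (Y4_gt0 0%N) Y4oo.
have EY0E : ('E_P[Y0] = (EY3 + EY4)%:E)%E.
  have aeW (Z : Omega -> R) : {ae P, forall w, 0 < Z w} ->
    {ae P, forall w, 0 <= Z w} by apply: filterS => w; exact: ltW.
  have := expectationD_pos (measurable_funPT (Y3 0%N))
    (measurable_funPT (Y4 0%N)) (aeW _ (Y3_gt0 0%N)) (aeW _ (Y4_gt0 0%N)).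
  by rewrite EY3E EY4E.
have lam_gt0 : 0 < lam by rewrite !addr_gt0.
have EY0_gt0 : 0 < EY3 + EY4 by exact: addr_gt0.
have D_gt0 : 0 < D by rewrite !addr_gt0// mulr_gt0.
have Y0_gt0 := total_gt0 (Y3_gt0 0%N) (Y4_gt0 0%N).
have Y_ge0 := claim_ge0 iidS iidY1 iidY2 iidY34 iidI S_gt0 NS indep
  l0_gt0 l1_gt0 l2_gt0 onehot
  (Y1_gt0 0%N) (Y2_gt0 0%N) (Y3_gt0 0%N) (Y4_gt0 0%N).
have mixture := claim_mixture iidS iidY1 iidY2 iidY34 iidI S_gt0 NS indep
  l0_gt0 l1_gt0 l2_gt0 onehot.
have mY k : measurable_fun setT (Y k).
  exact: (measurable_claim Y1 Y2 Y3 Y4 I1 I2 I0 k).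
have EYE : ('E_P[Y 0%N] = (D / lam)%:E)%E.
  rewrite expectation_pos_part// (mixture 0%N _ (@measurable_pos_part R))//;
    last exact: pos_part_ge0.
  have posE (Z : Omega -> R) (e : R) : measurable_fun setT Z ->
      {ae P, forall w, 0 < Z w} -> 'E_P[Z]%E = e%:E ->
      (\int[P]_w (Num.max 0 (Z w))%:E)%E = e%:E.
    move=> mZ Z0 <-; rewrite expectation_pos_part//.
    by apply: filterS Z0 => w; exact: ltW.
  rewrite (posE _ EY1)// (posE _ EY2)// (posE _ (EY3 + EY4))//.
  rewrite -!EFinM -!EFinD /D; congr EFin.
  by rewrite -/lam !(mulrAC _ lam^-1) -!mulrDl.
have tailE := claim_tail_integral iidS iidY1 iidY2 iidY34 iidI S_gt0 NS indep
  l0_gt0 l1_gt0 l2_gt0 onehot.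
have itailE y : itail_cdf P (Y 0%N) y =
    ((p1 / EY1)%:E * tail_integral P (Y1 0%N) y
     + (p0 / (EY3 + EY4))%:E * tail_integral P Y0 y
     + (p2 / EY2)%:E * tail_integral P (Y2 0%N) y)%E.
  have wE l (e : R) : e != 0 -> (l * e / D / e = l / D)%R.
    by move=> e0; rewrite mulrAC mulfK.
  rewrite /itail_cdf EYE tailE inver gt_eqF ?divr_gt0// invf_div.
  rewrite !wE ?gt_eqF//.
  have s0 (l : R) Z : 0 < l -> (0 <= (l / lam)%:E * tail_integral P Z y)%E.
    move=> l_gt0; apply: mule_ge0; last exact: tail_integral_ge0.
    by rewrite lee_fin divr_ge0 ?ltW.
  have c2 l : ((lam / D)%:E * (l / lam)%:E = (l / D)%:E)%E.
    by rewrite -EFinM mulrC mulrA divfK ?gt_eqF.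
  rewrite ge0_muleDr; [|by apply: adde_ge0; exact: s0|exact: s0].
  rewrite ge0_muleDr; [|exact: s0|exact: s0].
  by rewrite !muleA !c2 -addeA [X in (_ + X)%E]addeC addeA.
split; first by move=> y _; exact: itailE.
move=> d' Omega' P' J1 J2 J0 t1 t2 t0 d'' Omega'' P'' eta.
move=> onehotJ law1 law2 law0 indepJ law_eta.
have lawS k (A : set R) : measurable A ->
    P (S k @^-1` A) = exponential_prob lam A.
  by move=> mA; rewrite iidS.2// lawS0.
have EYint : (\int[P]_w (Y 0%N w)%:E = (D / lam)%:E)%E by rewrite -EYE unlock.
have net : (\int[P]_w (Y 0%N w)%:E < ((lam / c)^-1)%:E)%E.
  by rewrite EYint lte_fin invf_div ltr_pM2r ?invr_gt0.
have idY := same_law_claim iidS iidY1 iidY2 iidY34 iidI S_gt0 NS indep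
  l0_gt0 l1_gt0 l2_gt0 onehot.
have indepYS :=
  independent2_claim_gap iidS iidY1 iidY2 iidY34 iidI S_gt0 NS indep.
have indepX := independent2_stopped iidS iidY1 iidY2 iidY34 iidI S_gt0 NS indep
  (c := c).
have deficitE := deficit_integrated_tail lam_gt0 c_gt0 S_gt0 NS lawS mY idY
  Y_ge0 net indepYS indepX EYint (divr_gt0 D_gt0 lam_gt0).
apply: same_law_cdf => //.
  by apply: measurable_funD; first apply: measurable_funD;
    exact: measurable_funM.
move=> t; rewrite law_eta; last exact: measurable_itv.
rewrite deficitE.
(* Each variable theta is a function of the triple, hence independent of J. *)
have indepJt (theta : {RV P' >-> R}) (f : R * R * R -> R) :
    measurable_fun setT f -> (forall w, theta w = f (t1 w, t2 w, t0 w)) ->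
    independent2 P' (sigma_rv (fun w => (J1 w, J2 w, J0 w))) (sigma_rv theta).
  move=> mf thetaE A B JA [C mC <-].
  rewrite muleC setIC; apply: indepJ => //; exists (f @^-1` C).
    by rewrite -[X in measurable X]setTI; exact: mf.
  by congr (_ `&` _); apply/seteqP; split => w /=; rewrite thetaE.
have it1 := indepJt t1 _ (measurableT_comp measurable_fst measurable_fst)
  (fun w => erefl).
have it2 := indepJt t2 _ (measurableT_comp measurable_snd measurable_fst)
  (fun w => erefl).
have it0 := indepJt t0 _ measurable_snd (fun w => erefl).
have p1E : p1 + p2 + p0 = 1.
  by rewrite /p1 /p2 /p0 -!mulrDl divff// gt_eqF.
have setE (Z : Omega' -> R) : Z @^-1` `]-oo, t] = [set w | Z w <= t].
  by apply/seteqP; split => w /=; rewrite in_itv.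
rewrite setE.
rewrite (one_hot_cdf (measurable_funPT J1) (measurable_funPT J2)
  (measurable_funPT J0) (measurable_funPT t1) (measurable_funPT t2)
  (measurable_funPT t0) p1E onehotJ it1 it2 it0 t).
(* The integrated tail laws are carried by the half-line, so that both c.d.f.s
   vanish for t < 0. *)
have [t_ge0|t_lt0] := leP 0 t; last first.
  have null (theta : {RV P' >-> R}) : P' [set w | theta w < 0] = 0%E ->
      P' [set w | theta w <= t] = 0%E.
    move=> theta0; apply/eqP; rewrite eq_le measure_ge0 andbT -theta0.
    have mtheta (I : interval R) : measurable (theta @^-1` [set` I]).
      by rewrite -[X in measurable X]setTI; exact: measurable_funPT.
    apply: le_measure; rewrite ?inE.
    - by have := mtheta `]-oo, t]; rewrite setE.
    - rewrite (_ : [set w | _] = theta @^-1` `]-oo, 0[); first exact: mtheta.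
      by apply/seteqP; split => w /=; rewrite in_itv.
    - by move=> w /= /le_lt_trans; exact.
  by rewrite (null t1 law1.1) (null t2 law2.1) (null t0 law0.1) !mule0 !adde0.
rewrite law1.2// law2.2// law0.2// itailE /itail_cdf EY1E EY2E EY0E.
rewrite !inver !gt_eqF// !muleA -!EFinM.
by rewrite -addeA [X in (_ + X)%E]addeC addeA.
Qed.
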